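(* Let $N\ge 1$, let $Z_N=Z(\mathrm U(\mathfrak q_N))$, let $c_{2r-1}\in Z_N$ ($r\ge1$) be Sergeev's odd cyclic elements, and let $\mathcal D_N(u)=\sum_{r\ge0}\frac{D_r}{(u\downarrow r)}\in Z_N[[u^{-1}]]$ be the series of normalized one-row Capelli elements. Then in $Z_N[[u^{-1}]]$ one has $$\frac{\mathcal D_N(u)}{\mathcal D_N(u-1)}=1-\sum_{r\ge1}\frac{c_{2r-1}}{[u(u+1)]^r}.$$
   Context: Ground field $\mathbb C$. Queer Lie superalgebra: fix $N\ge1$, $I_N=\{-N,\dots,-1,1,\dots,N\}$, $\bar i=0$ if $i>0$ and $\bar i=1$ if $i<0$. Let $E_{ij}$ ($i,j\in I_N$) be the matrix units of $\mathfrak{gl}(N|N)$, of parity $\bar i+\bar j$ mod $2$. $\mathfrak q_N\subset\mathfrak{gl}(N|N)$ is the Lie sub-superalgebra spanned by $F_{ij}=E_{ij}+E_{-i,-j}$ (so $F_{-i,-j}=F_{ij}$). $\mathrm U(\mathfrak q_N)$ is its universal enveloping algebra and $Z_N=Z(\mathrm U(\mathfrak q_N))$ its center (in the superalgebra sense; all central elements are even). Harish-Chandra map: $\mathfrak h_{\bar0}=\bigoplus_{i=1}^N\mathbb C F_{ii}$, $\mathfrak h_{\bar 1}=\bigoplus_{i=1}^N\mathbb C F_{i,-i}$, $\mathfrak n_+$ (resp. $\mathfrak n_-$) is the span of $F_{ij},F_{i,-j}$ with $1\le i<j\le N$ (resp. $1\le j<i\le N$). For $z\in Z_N$, $\mathrm{HC}(z)\in\mathbb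 C[\lambda_1,\dots,\lambda_N]$ is the polynomial with $z\equiv \mathrm{HC}(z)|_{\lambda_i=F_{ii}}$ modulo $\mathfrak n_-\mathrm U(\mathfrak q_N)+\mathrm U(\mathfrak q_N)\mathfrak n_+$ (no $\rho$-shift). It is known that $\mathrm{HC}$ is an algebra isomorphism of $Z_N$ onto $\Gamma_N$, the algebra of symmetric polynomials $f\in\mathbb C[\lambda_1,\dots,\lambda_N]$ such that $f(t,-t,\lambda_3,\dots,\lambda_N)$ is independent of $t$ (no condition if $N=1$). Cyclic elements: for $r\ge1$, $$c_r=\sum_{i_1,\dots,i_r\in I_N}(-1)^{\bar i_2+\cdots+\bar i_r}F_{i_1i_2}F_{i_2i_3}\cdots F_{i_ri_1}\in \mathrm U(\mathfrak q_N);$$ these are known to be central. Normalized one-row Capelli elements: $(u\downarrow r)=u(u-1)\cdots(u-r+1)$, $(u\downarrow0)=1$. Let $Q^-_{(0)}=1$ and for $r\ge1$ let $Q^-_{(r)}\in\Gamma_N$ be the one-row factorial Schur $Q$-polynomial $Q^-_{(r)}(\lambda)=2\sum_{i=1}^N(\lambda_i\downarrow r)\prod_{j\ne i}\frac{\lambda_i+\lambda_j}{\lambda_i-\lambda_j}$; equivalently $\sum_{r\ge0}Q^-_{(r)}(\lambda)/(u\downarrow r)=\prod_{i=1}^N\frac{u+1+\lambda_i}{u+1-\lambda_i}$. Then $D_0=1$ and $D_r=\frac1{r!}C_{(r)}$ for $r\ge1$, where $C_{(r)}$ is Nazarov's Capelli element of the one-row strict partition $(r)$; $D_r$ is the unique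 element of $Z_N$ with $\mathrm{HC}(D_r)=Q^-_{(r)}$. Series are expanded at $u=\infty$ in the $u^{-1}$-adic topology, and quotients of series with constant term $1$ are taken in this formal sense. *)

(* Defs.v *)
From HB Require Import structures.
From mathcomp Require Import all_boot all_order all_algebra.
From mathcomp Require Import generic_quotient fraction.
From mathcomp Require Import boolp reals.
From mathcomp Require Import complex.
From mathcomp Require Import mpoly.

Set Implicit Arguments.
Unset Strict Implicit.
Unset Printing Implicit Defensive.

Import GRing.Theory.

Local Open Scope ring_scope.
Local Open Scope quotient_scope.
Local Notation "x %:F" := (@tofrac _ x).

(** * Lie sub-superalgebras of gl(m|n) and their enveloping algebras *)

(* The first m indices are even, the last n are odd. *)
Definition ipar (m n : nat) (a : 'I_(m + n)) : bool := (m <= a)%N.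

Definition mx_homog (K : fieldType) (m n : nat) (p : bool)
    (X : 'M[K]_(m + n)) : Prop :=
  forall a b, X a b != 0 -> ipar a (+) ipar b = p.

(* For homogeneous X, Y of parities p, q. *)
Definition superbracket (K : fieldType) (m n : nat) (p q : bool)
    (X Y : 'M[K]_(m + n)) : 'M[K]_(m + n) :=
  X *m Y - (-1) ^+ (p && q) *: (Y *m X).

(* U(g) for a Lie sub-superalgebra g of gl(m|n), as the K-algebra presented by
   the generators x in g, the linear relations of g, and
   xy - (-1)^(|x||y|) yx = [x, y] for homogeneous x, y: formal expressions
   modulo the smallest congruence containing the axioms of associative unital
   K-algebras and these relations.  [UScal a] stands for a times the unit, and
   - x for (-1) x. *)
Section EnvelopingAlgebra.
Variables (K : fieldType) (m n : nat) (g : {vspace 'M[K]_(m + n)}).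

Inductive uterm : Type :=
| UGen of subvs_of g
| UScal of K
| UAdd of uterm & uterm
| UMul of uterm & uterm.

Inductive ueq : uterm -> uterm -> Prop :=
| ueq_refl x : ueq x x
| ueq_sym x y : ueq x y -> ueq y x
| ueq_trans x y z : ueq x y -> ueq y z -> ueq x z
| ueq_add x x' y y' : ueq x x' -> ueq y y' -> ueq (UAdd x y) (UAdd x' y')
| ueq_mul x x' y y' : ueq x x' -> ueq y y' -> ueq (UMul x y) (UMul x' y')
| ueq_addA x y z : ueq (UAdd x (UAdd y z)) (UAdd (UAdd x y) z)
| ueq_addC x y : ueq (UAdd x y) (UAdd y x)
| ueq_add0 x : ueq (UAdd (UScal 0) x) x
| ueq_mulA x y z : ueq (UMul x (UMul y z)) (UMul (UMul x y) z)
| ueq_mul0 x : ueq (UMul (UScal 0) x) (UScal 0)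
| ueq_mul1 x : ueq (UMul (UScal 1) x) x
| ueq_mulDl x y z : ueq (UMul (UAdd x y) z) (UAdd (UMul x z) (UMul y z))
| ueq_mulDr x y z : ueq (UMul x (UAdd y z)) (UAdd (UMul x y) (UMul x z))
| ueq_scalD a b : ueq (UAdd (UScal a) (UScal b)) (UScal (a + b))
| ueq_scalM a b : ueq (UMul (UScal a) (UScal b)) (UScal (a * b))
| ueq_scalC a x : ueq (UMul (UScal a) x) (UMul x (UScal a))
| ueq_lin a (x y : subvs_of g) :
    ueq (UGen (a *: x + y)) (UAdd (UMul (UScal a) (UGen x)) (UGen y))
| ueq_bracket p q (x y z : subvs_of g) :
    mx_homog p (vsval x) -> mx_homog q (vsval y) ->
    vsval z = superbracket p q (vsval x) (vsval y) ->
    ueq (UAdd (UMul (UGen x) (UGen y))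
              (UMul (UScal (- (-1) ^+ (p && q))) (UMul (UGen y) (UGen x))))
        (UGen z).

HB.instance Definition _ := gen_eqMixin uterm.
HB.instance Definition _ := gen_choiceMixin uterm.

Definition ueqb : rel uterm := fun x y => `[< ueq x y >].

Lemma ueqb_refl : reflexive ueqb.
Proof. by move=> x; apply/asboolP; exact: ueq_refl. Qed.

Lemma ueqb_sym : ssrbool.symmetric ueqb.
Proof. by move=> x y; apply/asboolP/asboolP; exact: ueq_sym. Qed.

Lemma ueqb_trans : transitive ueqb.
Proof.
by move=> y x z /asboolP xy /asboolP yz; apply/asboolP; exact: ueq_trans yz.
Qed.

Canonical ueq_equiv := EquivRel ueqb ueqb_refl ueqb_sym ueqb_trans.

Definition uea : Type := {eq_quot ueq_equiv}.
HB.instance Definition _ := Choice.on uea.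
HB.instance Definition _ := EqQuotient.on uea.

Lemma uea_eq x y : ueq x y <-> \pi_uea x = \pi_uea y.
Proof.
split=> [xy|/eqP]; first by apply/eqP; rewrite piE; apply/asboolP.
by rewrite piE => /asboolP.
Qed.

Lemma ueq_repr x : ueq (repr (\pi_uea x)) x.
Proof. by apply/uea_eq; rewrite reprK. Qed.

Definition uadd (x y : uea) : uea := \pi_uea (UAdd (repr x) (repr y)).
Definition umul (x y : uea) : uea := \pi_uea (UMul (repr x) (repr y)).
Definition uscal (a : K) : uea := \pi_uea (UScal a).
Definition uopp (x : uea) : uea := umul (uscal (-1)) x.
Definition uscale (a : K) (x : uea) : uea := umul (uscal a) x.

Lemma uaddE x y : uadd (\pi x) (\pi y) = \pi_uea (UAdd x y).
Proof. by apply/uea_eq; apply: ueq_add; exact: ueq_repr. Qed.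

Lemma umulE x y : umul (\pi x) (\pi y) = \pi_uea (UMul x y).
Proof. by apply/uea_eq; apply: ueq_mul; exact: ueq_repr. Qed.

Lemma uaddA : associative uadd.
Proof.
elim/quotW=> x; elim/quotW=> y; elim/quotW=> z.
by rewrite !uaddE; apply/uea_eq; exact: ueq_addA.
Qed.

Lemma uaddC : commutative uadd.
Proof.
elim/quotW=> x; elim/quotW=> y.
by rewrite !uaddE; apply/uea_eq; exact: ueq_addC.
Qed.

Lemma uadd0 : left_id (uscal 0) uadd.
Proof. by elim/quotW=> x; rewrite uaddE; apply/uea_eq; exact: ueq_add0. Qed.

Lemma umulA : associative umul.
Proof.
elim/quotW=> x; elim/quotW=> y; elim/quotW=> z.
by rewrite !umulE; apply/uea_eq; exact: ueq_mulA.
Qed.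

Lemma umul1 : left_id (uscal 1) umul.
Proof. by elim/quotW=> x; rewrite umulE; apply/uea_eq; exact: ueq_mul1. Qed.

Lemma uscalC a x : umul (uscal a) x = umul x (uscal a).
Proof.
by elim/quotW: x => x; rewrite !umulE; apply/uea_eq; exact: ueq_scalC.
Qed.

Lemma umulr1 : right_id (uscal 1) umul.
Proof. by move=> x; rewrite -uscalC umul1. Qed.

Lemma umulDl : left_distributive umul uadd.
Proof.
elim/quotW=> x; elim/quotW=> y; elim/quotW=> z.
by rewrite uaddE !umulE uaddE; apply/uea_eq; exact: ueq_mulDl.
Qed.

Lemma umulDr : right_distributive umul uadd.
Proof.
elim/quotW=> x; elim/quotW=> y; elim/quotW=> z.
by rewrite uaddE !umulE uaddE; apply/uea_eq; exact: ueq_mulDr.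
Qed.

Lemma uscalD a b : uadd (uscal a) (uscal b) = uscal (a + b).
Proof. by rewrite uaddE; apply/uea_eq; exact: ueq_scalD. Qed.

Lemma uscalM a b : umul (uscal a) (uscal b) = uscal (a * b).
Proof. by rewrite umulE; apply/uea_eq; exact: ueq_scalM. Qed.

Lemma uaddN : left_inverse (uscal 0) uopp uadd.
Proof.
elim/quotW=> x; rewrite /uopp -{2}[\pi x]umul1 -umulDl uscalD addNr umulE.
by apply/uea_eq; exact: ueq_mul0.
Qed.

(* The counit U(g) -> K, which sends g to 0, separates 1 from 0. *)
Fixpoint uterm_counit (x : uterm) : K :=
  match x with
  | UGen _ => 0
  | UScal a => a
  | UAdd x y => uterm_counit x + uterm_counit y
  | UMul x y => uterm_counit x * uterm_counit y
  end.

Lemma ueq_counit x y : ueq x y -> uterm_counit x = uterm_counit y.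
Proof.
elim=> //= *; rewrite ?(addrA, mulrA, add0r, mul0r, mul1r, mulrDl, mulrDr,
  mulr0, addr0) //; first [congruence | exact: addrC | exact: mulrC].
Qed.

Lemma uscal1_neq0 : uscal 1 != uscal 0.
Proof.
by apply/eqP => /uea_eq /ueq_counit /= /eqP; rewrite oner_eq0.
Qed.

HB.instance Definition _ := GRing.isZmodule.Build uea uaddA uaddC uadd0 uaddN.
HB.instance Definition _ := GRing.Zmodule_isNzRing.Build uea
  umulA umul1 umulr1 umulDl umulDr uscal1_neq0.

Lemma uscaleA a b x : uscale a (uscale b x) = uscale (a * b) x.
Proof. by rewrite /uscale umulA uscalM. Qed.

Lemma uscale1 : left_id 1 uscale.
Proof. exact: umul1. Qed.

Lemma uscaleDr : right_distributive uscale +%R.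
Proof. by move=> a x y; exact: umulDr. Qed.

Lemma uscaleDl x : {morph uscale^~ x : a b / a + b}.
Proof. by move=> a b; rewrite /uscale -uscalD umulDl. Qed.

HB.instance Definition _ := GRing.Zmodule_isLmodule.Build K uea
  uscaleA uscale1 uscaleDr uscaleDl.

Lemma uscaleAl a (x y : uea) : a *: (x * y) = a *: x * y.
Proof. exact: umulA. Qed.

HB.instance Definition _ := GRing.Lmodule_isLalgebra.Build K uea uscaleAl.

Lemma uscaleAr a (x y : uea) : a *: (x * y) = x * (a *: y).
Proof.
by change (umul (uscal a) (umul x y) = umul x (umul (uscal a) y));
   rewrite !umulA (uscalC a x).
Qed.

HB.instance Definition _ := GRing.Lalgebra_isAlgebra.Build K uea uscaleAr.

Definition uea_gen (x : subvs_of g) : uea := \pi_uea (UGen x).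

(* The Z/2-grading of U(g). *)
Inductive uea_homog : bool -> uea -> Prop :=
| uea_homog_scal a : uea_homog false a%:A
| uea_homog_gen p x : mx_homog p (vsval x) -> uea_homog p (uea_gen x)
| uea_homog_add p x y : uea_homog p x -> uea_homog p y -> uea_homog p (x + y)
| uea_homog_mul p q x y :
    uea_homog p x -> uea_homog q y -> uea_homog (p (+) q) (x * y).

Definition uea_supercentral (z : uea) : Prop :=
  exists z0 z1 : uea,
    [/\ z = z0 + z1, uea_homog false z0, uea_homog true z1 &
        forall q y, uea_homog q y ->
          z0 * y = y * z0 /\ z1 * y = (-1) ^+ q * (y * z1)].

End EnvelopingAlgebra.

(** * The queer Lie superalgebra *)

Section Queer.
Variables (K : fieldType) (N : nat).

(* I_N is 'I_(N + N): the index i in {1..N} is [ipos (i - 1)] and -i is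
   [ineg (ipos (i - 1))]. *)
Definition ipos (i : 'I_N) : 'I_(N + N) := lshift N i.

Definition ineg (a : 'I_(N + N)) : 'I_(N + N) :=
  match split a with
  | inl i => rshift N i
  | inr i => lshift N i
  end.

Definition Fmx (a b : 'I_(N + N)) : 'M[K]_(N + N) :=
  delta_mx a b + delta_mx (ineg a) (ineg b).

Definition qN : {vspace 'M[K]_(N + N)} := (\sum_a \sum_b <[Fmx a b]>)%VS.

Definition nplus : {vspace 'M[K]_(N + N)} :=
  (\sum_(i < N) \sum_(j < N | (i < j)%N)
     (<[Fmx (ipos i) (ipos j)]> + <[Fmx (ipos i) (ineg (ipos j))]>))%VS.

Definition nminus : {vspace 'M[K]_(N + N)} :=
  (\sum_(i < N) \sum_(j < N | (j < i)%N)
     (<[Fmx (ipos i) (ipos j)]> + <[Fmx (ipos i) (ineg (ipos j))]>))%VS.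

Lemma Fmx_qN a b : Fmx a b \in qN.
Proof.
by apply: (subvP (sumv_sup a isT (sumv_sup b isT (subvv _)))); exact: memv_line.
Qed.

Lemma inegK : involutive (ineg).
Proof.
move=> a; rewrite /ineg; case: (splitP a) => i ai.
  by rewrite -[rshift N i]/(unsplit (inr i)) unsplitK; apply: val_inj.
by rewrite -[lshift N i]/(unsplit (inl i)) unsplitK; apply: val_inj.
Qed.

Lemma Fmx_mul (a b c d : 'I_(N + N)) :
  Fmx a b *m Fmx c d =
  (b == c)%:R *: Fmx a d + (b == ineg c)%:R *: Fmx a (ineg d).
Proof.
have e1 : (ineg b == c) = (b == ineg c) by rewrite -(inj_eq (can_inj inegK)) inegK.
have e2 : (ineg b == ineg c) = (b == c) by rewrite (inj_eq (can_inj inegK)).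
rewrite /Fmx mulmxDl !mulmxDr !mul_delta_mx_cond inegK e1 e2.
rewrite !scaler_nat !mulrnDl [X in _ + X]addrC addrACA; congr (_ + _).
Qed.

Lemma qN_ind (P : 'M[K]_(N + N) -> Prop) :
  P 0 -> (forall X Y, P X -> P Y -> P (X + Y)) ->
  (forall k a b, P (k *: Fmx a b)) -> forall X, X \in qN -> P X.
Proof.
move=> P0 PD PF X /memv_sumP[Xs XsP ->]; apply: big_ind => // a _.
have /memv_sumP[Ys YsP ->] := XsP a isT; apply: big_ind => // b _.
by have /vlineP[k ->] := YsP b isT; exact: PF.
Qed.

Lemma qN_mulmx X Y : X \in qN -> Y \in qN -> X *m Y \in qN.
Proof.
move=> Xq Yq; elim/qN_ind: X / Xq => [|X1 X2 H1 H2|k a b].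
- by rewrite mul0mx mem0v.
- by rewrite mulmxDl memvD.
elim/qN_ind: Y / Yq => [|Y1 Y2 H1 H2|l c d].
- by rewrite mulmx0 mem0v.
- by rewrite mulmxDr memvD.
by rewrite -scalemxAl -scalemxAr Fmx_mul !memvZ ?memvD ?memvZ ?Fmx_qN.
Qed.

Lemma superbracket_qN p q X Y :
  X \in qN -> Y \in qN -> superbracket p q X Y \in qN.
Proof. by move=> Xq Yq; rewrite memvB ?memvZ ?qN_mulmx. Qed.
Definition Uq := uea qN.

Definition F (a b : 'I_(N + N)) : Uq := uea_gen (vsproj qN (Fmx a b)).

Lemma F_val a b : vsval (vsproj qN (Fmx a b)) = Fmx a b.
Proof. by rewrite vsprojK // Fmx_qN. Qed.

Definition ZN (z : Uq) : Prop := uea_supercentral z.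

(* c_r, with i_(k+1) written as [i k] for k < r; [ordS] is k + 1 mod r. *)
Definition cyclic_elt (r : nat) : Uq :=
  \sum_(i : {ffun 'I_r -> 'I_(N + N)})
    (-1) ^+ (\sum_(k < r | (0 < k)%N) ipar (i k)) *
      \prod_(k < r) F (i k) (i (ordS k)).

(* n_- U + U n_+ *)
Inductive hc_kernel : Uq -> Prop :=
| hc_kernel0 : hc_kernel 0
| hc_kernelD x y : hc_kernel x -> hc_kernel y -> hc_kernel (x + y)
| hc_kernelL (x : subvs_of qN) u :
    vsval x \in nminus -> hc_kernel (uea_gen x * u)
| hc_kernelR u (x : subvs_of qN) :
    vsval x \in nplus -> hc_kernel (u * uea_gen x).

(* f(F_11, ..., F_NN) *)
Definition cartan_eval (f : {mpoly K[N]}) : Uq :=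
  mmap (fun a : K => a%:A : Uq) (fun i => F (ipos i) (ipos i)) f.

(* HC(z) = f *)
Definition is_HC (z : Uq) (f : {mpoly K[N]}) : Prop :=
  hc_kernel (z - cartan_eval f).

(* The defining expression of the one-row factorial Schur Q-polynomial, in the
   field of rational functions (for r >= 1). *)
Definition Qfact (r : nat) : {fraction {mpoly K[N]}} :=
  2%:R * \sum_(i < N)
    (\prod_(k < r) ('X_i - k%:R))%:F *
      \prod_(j < N | j != i) (('X_i + 'X_j)%:F / ('X_i - 'X_j)%:F).

(* z is in Z_N and HC(z) = Q^-_(r) (for r >= 1). *)
Definition is_capelli (r : nat) (z : Uq) : Prop :=
  ZN z /\ exists2 f : {mpoly K[N]}, is_HC z f & f%:F = Qfact r.

End Queer.

(** * Formal series in u^-1 *)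

Section Series.

(* s n is the coefficient of u^-n. *)
Definition series (A : Type) := nat -> A.

Section Ring.
Variable A : nzRingType.

Definition sone : series A := fun n => (n == 0)%:R.
Definition ssub (f h : series A) : series A := fun n => f n - h n.
Definition smul (f h : series A) : series A :=
  fun n => \sum_(i < n.+1) f i * h (n - i)%N.
Definition spow (f : series A) (k : nat) : series A := iter k (smul f) sone.

(* Sum over r >= 0 in the u^-1-adic topology of series s r divisible by
   u^-r. *)
Definition ssum (s : nat -> series A) : series A :=
  fun n => \sum_(r < n.+1) s r n.

(* Inverse of a series f with constant term 1, as the sum of (1 - f)^k. *)
Definition sinv (f : series A) : series A := ssum (spow (ssub sone f)).

(* 1 / (u - a) *)
Definition uinv (a : A) : series A :=
  fun n => if n is k.+1 then a ^+ k else 0.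

(* 1 / (u - a \downarrow r) *)
Definition uinv_ffact (a : A) (r : nat) : series A :=
  \big[smul/sone]_(k < r) uinv (a + k%:R).

End Ring.

Variables (K : fieldType) (A : algType K).

Definition sscale (f : series K) (x : A) : series A := fun n => f n *: x.

(* D(u - a) for D(u) = sum_(r >= 0) D_r / (u \downarrow r) *)
Definition ffact_series (D : nat -> A) (a : K) : series A :=
  ssum (fun r => sscale (uinv_ffact a r) (D r)).

End Series.

(* Main.v *)
(** Both sides are compared through the Harish-Chandra map.

    Injectivity of HC on the centre.  U(q_N) acts faithfully on the tensor powers
    of V = C^(N|N): splitting off one tensor factor lowers the degree of an
    element, and multiplying the result out again recovers the element up to a
    nonzero factor and terms of lower degree.  The matrix of F_ba on a tensor
    power is the adjoint of that of F_ab, so the adjoint of n_+ is n_-, and a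
    central z in n_- U + U n_+ satisfies <z w, w'> = 0 for all highest weight
    vectors w, w'.  This forces z to act by zero.

    HC of the cyclic elements.  The commutation relations of F_ab with the entries
    of the r-th power of the matrix F show that c_r is central, and moving n_+ to
    the right gives, modulo n_- U + U n_+, a triangular recursion for the diagonal
    entries of the odd powers.  With w = u(u+1) it sums to
    1 - sum_r HC(c_(2r-1)) w^-r = prod_i (w - l_i(l_i+1)) / (w - l_i(l_i-1)).

    HC of the Capelli elements.  By partial fractions and a telescoping sum,
    HC(D_N(u-a)) = prod_i (u-a+1+l_i) / (u-a+1-l_i), and
    w - l(l+1) = (u+1+l)(u-l), w - l(l-1) = (u+1-l)(u+l). *)

Require Import Defs.
From HB Require Import structures.
From mathcomp Require Import all_boot all_order all_algebra.
From mathcomp Require Import generic_quotient fraction.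
From mathcomp Require Import boolp reals complex.
From mathcomp Require Import mpoly ring.

Set Implicit Arguments.
Unset Strict Implicit.
Unset Printing Implicit Defensive.

Import GRing.Theory.

Local Open Scope ring_scope.

(** * Universal enveloping algebras *)

Section EnvelopingAlgebra.
Variables (K : fieldType) (m n : nat) (g : {vspace 'M[K]_(m + n)}).

Local Notation U := (uea g).

(** An element of a presented algebra is shown to be zero here by letting it act. The tensor powers
    of V suit this purpose because the Hermitian form they carry is positive definite: vanishing of
    matrix coefficients between highest weight vectors becomes vanishing of an operator, with no
    decomposition of modules. This is why the ground field comes with a conjugation. Two obstacles
    shape the rest. A supercentral element may a priori have an odd part, which only supercommutes;
    it has to be removed before HC is multiplicative. And the quotient of series has coefficients
    whose HC is awkward, so the identity is proved in the form D_N(u) = c(u) D_N(u-1), whose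
    coefficients are finite sums of products of central elements. The number l(l-1) in the
    denominators is F_ii^2 - F_(i,-i)^2 evaluated at l, since F_(i,-i)^2 = F_ii: it is picked up
    over two successive powers of F, so the recursion runs over odd powers and is summed in powers
    of 1/(u(u+1)). *)

Lemma uea_ind (P : U -> Prop) :
  (forall x, P (uea_gen x)) -> (forall a, P a%:A) ->
  (forall x y, P x -> P y -> P (x + y)) ->
  (forall x y, P x -> P y -> P (x * y)) -> forall x, P x.
Proof.
move=> PG PS PD PM; elim/quotW; elim=> [x|a|x Px y Py|x Px y Py].
- exact: PG.
- have := PS a; rewrite -[a%:A]/(uscal g a * 1) mulr1 //.
- by rewrite -uaddE; apply: PD.
- by rewrite -umulE; apply: PM.
Qed.

Lemma uscalE a : uscal g a = a%:A.
Proof. by rewrite -[a%:A]/(uscal g a * 1) mulr1. Qed.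

Lemma uea_gen_is_linear : linear (@uea_gen K m n g).
Proof.
move=> a x y; rewrite -[a *: uea_gen x]/(uscal g a * uea_gen x).
apply: etrans; first by apply/uea_eq; exact: ueq_lin.
by rewrite -uaddE -umulE.
Qed.

HB.instance Definition _ :=
  GRing.isLinear.Build K (subvs_of g) U _ (@uea_gen K m n g) uea_gen_is_linear.

Lemma uea_bracket p q (x y z : subvs_of g) :
  mx_homog p (vsval x) -> mx_homog q (vsval y) ->
  vsval z = superbracket p q (vsval x) (vsval y) ->
  uea_gen x * uea_gen y - (-1) ^+ (p && q) *: (uea_gen y * uea_gen x)
  = uea_gen z.
Proof.
move=> hx hy hz; have /uea_eq := ueq_bracket hx hy hz.
by rewrite -uaddE -!umulE -scaleNr.
Qed.

Section Lift.
Variables (B : pzRingType) (eta : {rmorphism K -> B}).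
Hypothesis etaC : forall a b, eta a * b = b * eta a.
Variable phi : subvs_of g -> B.
Hypothesis phi_lin : forall a x y, phi (a *: x + y) = eta a * phi x + phi y.
Hypothesis phi_bracket : forall p q (x y z : subvs_of g),
  mx_homog p (vsval x) -> mx_homog q (vsval y) ->
  vsval z = superbracket p q (vsval x) (vsval y) ->
  phi x * phi y - (-1) ^+ (p && q) * (phi y * phi x) = phi z.

Fixpoint uterm_lift (x : uterm g) : B :=
  match x with
  | UGen x => phi x
  | UScal a => eta a
  | UAdd x y => uterm_lift x + uterm_lift y
  | UMul x y => uterm_lift x * uterm_lift y
  end.

Lemma ueq_lift x y : ueq x y -> uterm_lift x = uterm_lift y.
Proof.
elim=> //= *; rewrite ?rmorph0 ?rmorph1 ?rmorphD ?rmorphM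
  ?(addrA, mulrA, add0r, mul0r, mul1r, mulrDl, mulrDr) //;
  first [congruence | exact: addrC | exact: etaC | idtac].
match goal with h1 : mx_homog _ _, h2 : mx_homog _ _, h3 : vsval _ = _ |- _ =>
    rewrite -(phi_bracket h1 h2 h3) end.
by rewrite rmorphN rmorphXn rmorphN1 !mulNr mulrA.
Qed.

(** The universal property of U(g). Scalars enter a possibly zero ring through a central map,
    because the target will be a ring of matrices over U, which is zero for N = 0. [ueq_lift] makes
    the choice of representative harmless. *)
Definition uea_lift (x : U) : B := uterm_lift (repr x).

Lemma uea_lift_pi x : uea_lift (\pi_U x)%qT = uterm_lift x.
Proof. exact: ueq_lift (ueq_repr x). Qed.

Lemma uea_liftD x y : uea_lift (x + y) = uea_lift x + uea_lift y.
Proof.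
elim/quotW: x => x; elim/quotW: y => y.
by rewrite -[X in uea_lift X]/(uadd _ _) uaddE !uea_lift_pi.
Qed.

Lemma uea_liftM x y : uea_lift (x * y) = uea_lift x * uea_lift y.
Proof.
elim/quotW: x => x; elim/quotW: y => y.
by rewrite -[X in uea_lift X]/(umul _ _) umulE !uea_lift_pi.
Qed.

Lemma uea_lift_scal a : uea_lift a%:A = eta a.
Proof. by rewrite -uscalE uea_lift_pi. Qed.

Lemma uea_lift_gen x : uea_lift (uea_gen x) = phi x.
Proof. exact: uea_lift_pi. Qed.

End Lift.
End EnvelopingAlgebra.

(** * Generators of the queer Lie superalgebra *)

Section Queer.
Variables (K : fieldType) (N : nat).

Local Notation I := 'I_(N + N).
Local Notation U := (Uq K N).
Local Notation Fmx := (@Fmx K N).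
Local Notation F := (@F K N).
Local Notation ipos := (@ipos N).

Lemma ipar_ipos i : ipar (ipos i) = false.
Proof. by rewrite /ipar /= leqNgt ltn_ord. Qed.

Lemma ipar_ineg (a : I) : ipar (ineg a) = ~~ ipar a.
Proof.
rewrite /ineg /ipar; case: splitP => i -> /=.
  by rewrite leq_addr leqNgt ltn_ord.
by rewrite leq_addr leqNgt ltn_ord.
Qed.

Lemma ineg_eq (a b : I) : (ineg a == b) = (a == ineg b).
Proof. by rewrite -(inj_eq (can_inj (@inegK N))) inegK. Qed.

Lemma eq_ineg (a : I) : (a == ineg a) = false.
Proof. by apply/eqP => /(congr1 (@ipar N N)); rewrite ipar_ineg; case: ipar. Qed.

Lemma I_ind (P : I -> Prop) :
  (forall i, P (ipos i)) -> (forall i, P (ineg (ipos i))) -> forall a, P a.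
Proof.
move=> Pp Pn a; rewrite -[a]splitK; case: (split a) => i /=; first exact: Pp.
suff <- : ineg (ipos i) = rshift N i by exact: Pn.
by rewrite /ineg -[ipos i]/(unsplit (inl i)) unsplitK.
Qed.

Lemma big_I (R : nmodType) (f : I -> R) :
  \sum_a f a = \sum_(i < N) (f (ipos i) + f (ineg (ipos i))).
Proof.
rewrite big_split_ord /= big_split /=; congr (_ + _); apply: eq_bigr => i _.
by rewrite /ineg -[ipos i]/(unsplit (inl i)) unsplitK.
Qed.

Lemma big_ineg (R : nmodType) (f : I -> R) : \sum_a f (ineg a) = \sum_a f a.
Proof. by rewrite [RHS](reindex_inj (can_inj (@inegK N))). Qed.

Lemma Fmx_ineg a b : Fmx (ineg a) (ineg b) = Fmx a b.
Proof. by rewrite /Defs.Fmx !inegK addrC. Qed.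

Lemma F_ineg a b : F (ineg a) (ineg b) = F a b.
Proof. by rewrite /Defs.F Fmx_ineg. Qed.

Lemma FmxE a b c d :
  Fmx a b c d = ((c == a) && (d == b))%:R + ((c == ineg a) && (d == ineg b))%:R.
Proof. by rewrite !mxE. Qed.

Lemma qN_entry X a b : X \in qN K N -> X (ineg a) (ineg b) = X a b.
Proof.
elim/qN_ind => [|Y Z HY HZ|k c d]; rewrite ?mxE ?HY ?HZ //.
by rewrite !(inj_eq (can_inj (@inegK N))) !ineg_eq addrC.
Qed.

Lemma Fmx_homog a b : mx_homog (ipar a (+) ipar b) (Fmx a b).
Proof.
move=> c d; rewrite FmxE.
have [/andP[/eqP-> /eqP->]//|_] := boolP ((c == a) && (d == b)).
have [/andP[/eqP-> /eqP->]//|_] := boolP ((c == ineg a) && (d == ineg b)).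
  by rewrite !ipar_ineg addNb addbN negbK.
by rewrite addr0 eqxx.
Qed.

Lemma superbracket_homog p q (X Y : 'M[K]_(N + N)) :
  mx_homog p X -> mx_homog q Y -> mx_homog (p (+) q) (superbracket p q X Y).
Proof.
move=> hX hY a b; apply: contraNeq => npq.
have H p' q' (X' Y' : 'M[K]_(N + N)) :
  mx_homog p' X' -> mx_homog q' Y' -> p' (+) q' = p (+) q -> (X' *m Y') a b = 0.
  move=> h h' e; rewrite mxE big1 // => c _.
  have [->|/h hp] := eqVneq (X' a c) 0; first by rewrite mul0r.
  have [->|/h' hq] := eqVneq (Y' c b) 0; first by rewrite mulr0.
  case/negP: npq; rewrite -e -hp -hq.
  by case: (ipar a) (ipar b) (ipar c) => [] [] [].
rewrite /superbracket mxE [X in _ + X]mxE [X in - X]mxE (H _ _ _ _ hX hY) //.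
by rewrite (H _ _ _ _ hY hX) ?mulr0 ?subrr // addbC.
Qed.

Lemma F_valZ k a b : vsval (k *: vsproj (qN K N) (Fmx a b)) = k *: Fmx a b.
Proof. by rewrite linearZ /= F_val. Qed.

(** A matrix in q_N is unchanged when both indices are negated, so its rows of positive index
    determine it, and the entries there are its coordinates on the F_ib with i > 0. *)
Lemma subvs_qN_basis (x : subvs_of (qN K N)) :
  x = \sum_(i < N) \sum_b
        vsval x (ipos i) b *: vsproj (qN K N) (Fmx (ipos i) b).
Proof.
apply: val_inj => /=; rewrite linear_sum /=.
transitivity (\sum_(i < N) \sum_b vsval x (ipos i) b *: Fmx (ipos i) b);
  last first.
  apply: eq_bigr => i _; rewrite linear_sum.
  by apply: eq_bigr => b _; exact/esym/F_valZ.
apply/matrixP => a b; rewrite summxE.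
transitivity (\sum_(i < N) \sum_c vsval x (ipos i) c * Fmx (ipos i) c a b);
  last first.
  apply: eq_bigr => i _; rewrite summxE.
  by apply: eq_bigr => c _; rewrite [RHS]mxE.
under eq_bigr do under eq_bigr do rewrite FmxE.
elim/I_ind: a => j.
  rewrite (bigD1 j) //= (bigD1 b) //= !eqxx /= eq_ineg addr0 mulr1.
  rewrite !big1 ?addr0 // => [i|c].
    move=> nij; rewrite big1 // => c _.
    have -> : (ipos j == ipos i) = false.
      by rewrite (inj_eq (@lshift_inj _ _)) eq_sym; apply/negbTE.
    have -> : (ipos j == ineg (ipos i)) = false.
      by apply/eqP => /(congr1 (@ipar N N)); rewrite ipar_ineg !ipar_ipos.
    by rewrite addr0 mulr0.
  by rewrite eq_sym => /negbTE->; rewrite addr0 mulr0.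
rewrite (bigD1 j) //= (bigD1 (ineg b)) //= !eqxx /= inegK eqxx.
rewrite [_ == ipos j]eq_sym eq_ineg add0r mulr1.
rewrite -{1}[b]inegK qN_entry ?subvsP //.
rewrite !big1 ?addr0 // => [i|c].
  move=> nij; rewrite big1 // => c _.
  have -> : (ineg (ipos j) == ineg (ipos i)) = false.
    rewrite (inj_eq (can_inj (@inegK N))) (inj_eq (@lshift_inj _ _)) eq_sym.
    exact/negbTE.
  have -> : (ineg (ipos j) == ipos i) = false.
    by apply/eqP => /(congr1 (@ipar N N)); rewrite ipar_ineg !ipar_ipos.
  by rewrite addr0 mulr0.
by rewrite -ineg_eq eq_sym => /negbTE->; rewrite addr0 mulr0.
Qed.

Lemma uea_gen_basis (x : subvs_of (qN K N)) :
  uea_gen x = \sum_(i < N) \sum_b vsval x (ipos i) b *: F (ipos i) b.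
Proof.
rewrite {1}(subvs_qN_basis x) linear_sum; apply: eq_bigr => i _.
by rewrite linear_sum; apply: eq_bigr => b _; rewrite linearZ.
Qed.

Lemma Uq_ind (P : U -> Prop) :
  (forall i b, P (F (ipos i) b)) -> (forall a, P a%:A) ->
  (forall x y, P x -> P y -> P (x + y)) ->
  (forall x y, P x -> P y -> P (x * y)) -> forall x, P x.
Proof.
move=> PF PS PD PM; apply: uea_ind => // x; rewrite uea_gen_basis.
have P0 : P 0 by rewrite -(scale0r 1); exact: PS.
apply: big_ind => // i _; apply: big_ind => // b _.
by rewrite -[F _ _]mul1r scalerAl; apply: PM.
Qed.

Lemma linear4 (V W : lmodType K) (f : {linear V -> W}) k1 k2 k3 k4 s x1 x2 x3 x4 :
  f (k1 *: x1 + k2 *: x2 - s *: (k3 *: x3 + k4 *: x4)) =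
  k1 *: f x1 + k2 *: f x2 - s *: (k3 *: f x3 + k4 *: f x4).
Proof. by rewrite linearB linearD !linearZ linearD !linearZ. Qed.

Lemma FM a b c d :
  F a b * F c d = (-1) ^+ ((ipar a (+) ipar b) && (ipar c (+) ipar d)) *:
                    (F c d * F a b)
   + ((b == c)%:R *: F a d + (b == ineg c)%:R *: F a (ineg d)
   - (-1) ^+ ((ipar a (+) ipar b) && (ipar c (+) ipar d)) *:
       ((d == a)%:R *: F c b + (d == ineg a)%:R *: F c (ineg b))).
Proof.
set s := _ ^+ _; apply/eqP; rewrite addrC -subr_eq; apply/eqP.
pose G a b := vsproj (qN K N) (Fmx a b).
pose z := (b == c)%:R *: G a d + (b == ineg c)%:R *: G a (ineg d)
   - s *: ((d == a)%:R *: G c b + (d == ineg a)%:R *: G c (ineg b)).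
rewrite (@uea_bracket _ _ _ _ _ _ _ _ z) ?F_val; try exact: Fmx_homog.
  exact: linear4.
rewrite /superbracket !Fmx_mul /z.
have GE c' d' : vsval (G c' d') = Fmx c' d' by exact: F_val.
by rewrite -!GE; exact: linear4.
Qed.

End Queer.

(** * Coproduct and matrix coefficients *)

Lemma big_tuple_cons (R : nmodType) (T : finType) n (f : n.+1.-tuple T -> R) :
  \sum_t f t = \sum_x \sum_(t : n.-tuple T) f [tuple of x :: t].
Proof.
rewrite pair_big (reindex (fun p : T * n.-tuple T => [tuple of p.1 :: p.2])) //=.
exists (fun t => (thead t, [tuple of behead t])) => [[x t] _|t _] /=.
  by congr (_, _); apply: val_inj.
by rewrite -tuple_eta.
Qed.

Lemma subr_common (V : zmodType) (A B C D E G : V) :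
  A + B + C + D - (E + C + B + G) = (A - E) + (D - G).
Proof.
rewrite -[A + B + C]addrA -[E + C + B]addrA [C + B]addrC opprD.
by rewrite addrACA [in LHS]opprD [X in X + _]addrACA subrr addr0.
Qed.

Section Coproduct.
Variables (K : fieldType) (N : nat).

Local Notation I := 'I_(N + N).
Local Notation U := (Uq K N).
Local Notation Fmx := (@Fmx K N).
Local Notation F := (@F K N).
Local Notation ipos := (@ipos N).

(* x acts on U (x) V as x (x) s^|x| + 1 (x) x, where s is the parity operator
   of V. *)
Definition delta_gen (x : subvs_of (qN K N)) : 'M[U]_(N + N) :=
  \matrix_(a, b)
    ((\sum_(i < N) \sum_c
        ((-1) ^+ (ipar a && ipar c) * vsval x (ipos i) c) *: F (ipos i) c)
       *+ (a == b) + (vsval x a b)%:A).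

Lemma delta_gen_homog p x : mx_homog p (vsval x) -> forall a b,
  delta_gen x a b =
  ((-1) ^+ (ipar a && p) *: uea_gen x) *+ (a == b) + (vsval x a b)%:A.
Proof.
move=> hx a b; rewrite mxE uea_gen_basis scaler_sumr.
congr (_ *+ _ + _); apply: eq_bigr => i _; rewrite scaler_sumr.
apply: eq_bigr => c _; rewrite scalerA.
have [->|/hx] := eqVneq (vsval x (ipos i) c) 0; first by rewrite !mulr0.
by rewrite ipar_ipos /= => ->.
Qed.

Lemma delta_gen_lin k x y :
  delta_gen (k *: x + y) =
  (scalar_mx \o in_alg U) k * delta_gen x + delta_gen y.
Proof.
suff H w : vsval w = k *: vsval x + vsval y -> delta_gen w =
    (scalar_mx \o in_alg U) k * delta_gen x + delta_gen y by exact: H.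
rewrite -[_ * _]/(_ *m _) /= mul_scalar_mx => E; apply/matrixP => a b.
have {}E c d : vsval w c d = k * vsval x c d + vsval y c d by rewrite E !mxE.
rewrite !mxE.
rewrite mulrDr mulrnAr addrACA -mulrnDl mulr_algl E; congr (_ *+ _ + _).
  rewrite scaler_sumr -big_split; apply: eq_bigr => i _.
  rewrite scaler_sumr -big_split; apply: eq_bigr => c _ /=.
  by rewrite E scalerA -scalerDl; congr (_ *: _); ring.
by rewrite scalerDl mulr_algl scalerA.
Qed.

(** The parity operator s anticommutes with odd matrices ([hX] and [hY], entry by entry), so the
    cross terms in x (x) s^p y and y (x) x s^q cancel in the superbracket. What remains is [x, y]
    (x) s^(p+q) + 1 (x) [x, y]. *)
Lemma delta_gen_bracket p q (x y z : subvs_of (qN K N)) :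
  mx_homog p (vsval x) -> mx_homog q (vsval y) ->
  vsval z = superbracket p q (vsval x) (vsval y) ->
  delta_gen x * delta_gen y - (-1) ^+ (p && q) * (delta_gen y * delta_gen x)
  = delta_gen z.
Proof.
have M p' q' (x' y' : subvs_of (qN K N)) a b :
    mx_homog p' (vsval x') -> mx_homog q' (vsval y') ->
    (delta_gen x' *m delta_gen y') a b =
    ((-1) ^+ (ipar a && (p' (+) q')) *: (uea_gen x' * uea_gen y')) *+ (a == b)
    + ((-1) ^+ (ipar a && p') * vsval y' a b) *: uea_gen x'
    + ((-1) ^+ (ipar b && q') * vsval x' a b) *: uea_gen y'
    + ((vsval x' *m vsval y') a b)%:A.
  move=> hx hy; rewrite mxE.
  under eq_bigr do rewrite (delta_gen_homog hx) (delta_gen_homog hy) mulrDl !mulrDr.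
  rewrite !big_split /= -!addrA; congr (_ + _); last congr (_ + _).
  - rewrite (bigD1 a) //= eqxx big1 => [|c]; last first.
      by rewrite eq_sym => /negbTE->; rewrite mul0r.
    rewrite addr0 mulrnAr; congr (_ *+ _).
    rewrite -scalerAl -scalerAr scalerA; congr (_ *: _).
    by case: (ipar a) p' q' {hx hy} => [] [] [];
      rewrite ?(expr0, expr1, mulr1, mul1r) ?mulrNN ?mulr1.
  - rewrite (bigD1 a) //= eqxx big1 => [|c]; last first.
      by rewrite eq_sym => /negbTE->; rewrite mul0r.
    by rewrite addr0 -scalerAl mulr_algr scalerA.
  congr (_ + _).
    rewrite (bigD1 b) //= eqxx big1 => [|c]; last first.
      by move=> /negbTE->; rewrite mulr0.
    by rewrite addr0 mulr_algl scalerA mulrC.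
  rewrite mxE scaler_suml; apply: eq_bigr => c _.
  by rewrite mulr_algl scalerA.
move=> hx hy hz.
have hz' : mx_homog (p (+) q) (vsval z).
  by rewrite hz; exact: superbracket_homog.
have -> : (-1) ^+ (p && q) * (delta_gen y * delta_gen x) =
    (in_alg U ((-1) ^+ (p && q))) *: (delta_gen y *m delta_gen x).
  case: (p && q); rewrite ?expr0 ?expr1 ?rmorphN ?rmorph1 ?mulNr ?scaleNr.
    by rewrite scale1r mul1r.
  by rewrite scale1r mul1r.
apply/matrixP => a b.
rewrite mxE [X in _ + X]mxE [X in - X]mxE (M _ _ _ _ _ _ hx hy).
rewrite (M _ _ _ _ _ _ hy hx) (delta_gen_homog hz') -(uea_bracket hx hy hz) hz.
have -> : superbracket p q (vsval x) (vsval y) a b = (vsval x *m vsval y) a b -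
    (-1) ^+ (p && q) * (vsval y *m vsval x) a b.
  by rewrite /superbracket [LHS]mxE [X in _ + X]mxE [X in - X]mxE.
rewrite mulr_algl.
set s := _ ^+ (p && q); rewrite [q (+) p]addbC.
have hX : (-1) ^+ (ipar b && q) * vsval x a b =
          s * ((-1) ^+ (ipar a && q) * vsval x a b).
  rewrite /s; have [->|/hx <-] := eqVneq (vsval x a b) 0; first by rewrite !mulr0.
  rewrite mulrA -signr_addb; congr (_ ^+ _ * _).
  by case: (ipar a) (ipar b) q {hy hz M s hx hz'} => [] [] [].
have hY : (-1) ^+ (ipar a && p) * vsval y a b =
          s * ((-1) ^+ (ipar b && p) * vsval y a b).
  rewrite /s; have [->|/hy <-] := eqVneq (vsval y a b) 0; first by rewrite !mulr0.
  rewrite mulrA -signr_addb; congr (_ ^+ _ * _).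
  by case: (ipar a) (ipar b) p {hy hz M s hx hz' hX} => [] [] [].
rewrite hX hY !scalerDr !scalerA !scalerDl.
rewrite subr_common scaleNr mulrnDl; congr (_ + _ + _).
by rewrite -scalerMnr scalerA mulrN1 mulNr scaleNr mulrC mulNrn.
Qed.

(** The coproduct with the vector representation applied to its second factor, where U (x) End V is
    read as matrices over U. Iterating it entrywise gives the action on tensor powers. *)
Definition delta : U -> 'M[U]_(N + N) := uea_lift (scalar_mx \o in_alg U) delta_gen.

Lemma scalar_mx_central k (B : 'M[U]_(N + N)) :
  (scalar_mx \o in_alg U) k * B = B * (scalar_mx \o in_alg U) k.
Proof.
rewrite -[_ * B]/(_ *m _) -[B * _]/(B *m _) /= mul_scalar_mx.
apply/matrixP => a b; rewrite !mxE (bigD1 b) //= mxE eqxx big1 => [|c].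
  by rewrite addr0 mulr_algl mulr_algr.
by move=> /negbTE ncb; rewrite mxE ncb mulr0.
Qed.

Lemma deltaD x y a b : delta (x + y) a b = delta x a b + delta y a b.
Proof.
by rewrite /delta (uea_liftD scalar_mx_central delta_gen_lin delta_gen_bracket) mxE.
Qed.

Lemma deltaM x y a b : delta (x * y) a b = \sum_c delta x a c * delta y c b.
Proof.
rewrite /delta (uea_liftM scalar_mx_central delta_gen_lin delta_gen_bracket).
by rewrite mxE.
Qed.

Lemma delta_scal k a b : delta k%:A a b = k%:A *+ (a == b).
Proof.
rewrite /delta (uea_lift_scal scalar_mx_central delta_gen_lin delta_gen_bracket).
by rewrite mxE.
Qed.

Lemma delta_F c d a b : delta (F c d) a b =
  ((-1) ^+ (ipar a && (ipar c (+) ipar d)) *: F c d) *+ (a == b)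
  + (Fmx c d a b)%:A.
Proof.
rewrite /delta.
rewrite (uea_lift_gen scalar_mx_central delta_gen_lin delta_gen_bracket).
rewrite (@delta_gen_homog (ipar c (+) ipar d)) ?F_val //; exact: Fmx_homog.
Qed.

(* The matrix coefficients of u on V^(x)n, for words alpha, beta of length n. *)
Fixpoint wcoef (alpha beta : seq I) (u : U) : K :=
  match alpha, beta with
  | a :: alpha, b :: beta => wcoef alpha beta (delta u a b)
  | _, _ => uea_lift idfun (fun=> 0) u
  end.

Let counitC (k b : K) : idfun k * b = b * idfun k. Proof. exact: mulrC. Qed.
Let counit_lin (k : K) (x y : subvs_of (qN K N)) : 0 = idfun k * 0 + 0 :> K.
Proof. by rewrite mulr0 addr0. Qed.
Let counit_bracket p q (x y z : subvs_of (qN K N)) :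
  mx_homog p (vsval x) -> mx_homog q (vsval y) ->
  vsval z = superbracket p q (vsval x) (vsval y) ->
  0 * 0 - (-1) ^+ (p && q) * (0 * 0) = 0 :> K.
Proof. by rewrite mulr0 mulr0 subrr. Qed.

Lemma wcoefD alpha beta : {morph wcoef alpha beta : x y / x + y}.
Proof.
elim: alpha beta => [|a alpha IH] [|b beta] x y /=;
  try exact: (uea_liftD counitC counit_lin counit_bracket).
by rewrite deltaD IH.
Qed.

Lemma wcoefM n (alpha beta : n.-tuple I) x y :
  wcoef alpha beta (x * y) =
  \sum_(gamma : n.-tuple I) wcoef alpha gamma x * wcoef gamma beta y.
Proof.
elim: n => [|n IH] in alpha beta x y *.
  rewrite (tuple0 alpha) (tuple0 beta) /=.
  rewrite (uea_liftM counitC counit_lin counit_bracket).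
  rewrite (bigD1 [tuple]) //= big1 ?addr0 // => t.
  by case/eqP; exact: tuple0.
case/tupleP: alpha => a alpha; case/tupleP: beta => b beta; rewrite /= deltaM.
rewrite big_tuple_cons (big_morph _ (wcoefD _ _) (_ : wcoef _ _ 0 = 0)).
  by apply: eq_bigr => c _; rewrite IH.
by apply: (addIr (wcoef alpha beta 0)); rewrite -wcoefD !add0r.
Qed.

Lemma wcoef_scal n (alpha beta : n.-tuple I) k :
  wcoef alpha beta k%:A = k * (alpha == beta)%:R.
Proof.
elim: n => [|n IH] in alpha beta k *.
  rewrite (tuple0 alpha) (tuple0 beta) eqxx mulr1 /=.
  exact: (uea_lift_scal counitC counit_lin counit_bracket).
case/tupleP: alpha => a alpha; case/tupleP: beta => b beta.
rewrite -!val_eqE /= delta_scal eqseq_cons.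
case: eqP => _ /=; first by rewrite mulr1n IH.
by rewrite mulr0 mulr0n -(scale0r 1) IH mul0r.
Qed.

Lemma wcoefZ n (alpha beta : n.-tuple I) k x :
  wcoef alpha beta (k *: x) = k * wcoef alpha beta x.
Proof.
rewrite -mulr_algl wcoefM (bigD1 alpha) //= wcoef_scal eqxx mulr1 big1 ?addr0 //.
by move=> gamma; rewrite wcoef_scal eq_sym => /negbTE->; rewrite mulr0 mul0r.
Qed.

Lemma wcoef0 n (alpha beta : n.-tuple I) : wcoef alpha beta 0 = 0.
Proof. by rewrite -(scale0r 0) wcoefZ mul0r. Qed.

Lemma wcoefB n (alpha beta : n.-tuple I) x y :
  wcoef alpha beta (x - y) = wcoef alpha beta x - wcoef alpha beta y.
Proof. by rewrite -scaleN1r wcoefD wcoefZ mulN1r. Qed.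

Lemma wcoef_F0 c d : wcoef [::] [::] (F c d) = 0.
Proof. exact: (uea_lift_gen counitC counit_lin counit_bracket). Qed.

Lemma wcoef_F_cons n a b (alpha beta : n.-tuple I) c d :
  wcoef (a :: alpha) (b :: beta) (F c d) =
  ((-1) ^+ (ipar a && (ipar c (+) ipar d)) * wcoef alpha beta (F c d)) *+ (a == b)
  + Fmx c d a b *+ (alpha == beta).
Proof.
rewrite /= delta_F wcoefD wcoef_scal mulr_natr; congr (_ + _).
by case: eqP => _; rewrite ?wcoefZ // mulr0n wcoef0.
Qed.

End Coproduct.

(** * Faithfulness on the tensor powers *)

Section Filtration.
Variables (K : fieldType) (N : nat).

Local Notation I := 'I_(N + N).
Local Notation U := (Uq K N).
Local Notation Fmx := (@Fmx K N).
Local Notation F := (@F K N).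
Local Notation ipos := (@ipos N).

Inductive filt : nat -> U -> Prop :=
| filt_scal n a : filt n a%:A
| filt_add n x y : filt n x -> filt n y -> filt n (x + y)
| filt_mulF n x i b : filt n x -> filt n.+1 (x * F (ipos i) b).

(** The filtration step below n, with the convention that negative degree means zero, so that degree
    arguments also cover n = 0. *)
Definition filt_lt (n : nat) (x : U) : Prop :=
  if n is m.+1 then filt m x else x = 0.

Lemma filt_mulZ n k x : filt n x -> filt n (k *: x).
Proof.
move=> Fx; elim: Fx k => {n x} [n a|n x y _ IHx _ IHy|n x i b _ IHx] k.
- by rewrite scalerA; exact: filt_scal.
- by rewrite scalerDr; apply: filt_add.
- by rewrite scalerAl; apply: filt_mulF.
Qed.

Lemma filt0 n : filt n 0.
Proof. by rewrite -(scale0r 1); exact: filt_scal. Qed.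

Lemma filtS n x : filt n x -> filt n.+1 x.
Proof.
elim=> {n x} [n a|n x y _ Fx _ Fy|n x i b _ Fx]; first exact: filt_scal.
  exact: filt_add.
exact: filt_mulF.
Qed.

Lemma filt_sum n (J : finType) (P : pred J) (f : J -> U) :
  (forall j, P j -> filt n (f j)) -> filt n (\sum_(j | P j) f j).
Proof. move=> Ff; apply: big_ind => //; [exact: filt0 | exact: filt_add]. Qed.

Lemma filt_le m n x : (m <= n)%N -> filt m x -> filt n x.
Proof. by move=> /subnK<-; elim: (n - m)%N => // k IH /IH; exact: filtS. Qed.

Lemma filt_mul m n x y : filt m x -> filt n y -> filt (m + n) (x * y).
Proof.
move=> Fx; elim=> {n y} [n a|n y z _ IHy _ IHz|n y i b _ IHy].
- by rewrite mulr_algr; apply: filt_mulZ; apply: filt_le Fx; exact: leq_addr.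
- by rewrite mulrDr; apply: filt_add.
- by rewrite mulrA addnS; apply: filt_mulF.
Qed.

Lemma filt_F a b : filt 1 (F a b).
Proof.
elim/I_ind: a => i; rewrite -[F _ _]mul1r -(scale1r 1).
  by apply: filt_mulF; exact: filt_scal.
by rewrite -(F_ineg _ (ineg _)) inegK; apply: filt_mulF; exact: filt_scal.
Qed.

Lemma filt_exists x : exists n, filt n x.
Proof.
elim/Uq_ind: x => [i b|a|x y [m Fx] [n Fy]|x y [m Fx] [n Fy]].
- by exists 1%N; exact: filt_F.
- by exists 0%N; exact: filt_scal.
- exists (m + n)%N; apply: filt_add; first exact: filt_le (leq_addr _ _) Fx.
  exact: filt_le (leq_addl _ _) Fy.
- by exists (m + n)%N; exact: filt_mul.
Qed.

Lemma filt_lt_add n x y : filt_lt n x -> filt_lt n y -> filt_lt n (x + y).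
Proof. by case: n => [/= -> ->|n]; [rewrite addr0 | exact: filt_add]. Qed.

Lemma filt_lt0 n : filt_lt n 0.
Proof. by case: n => // n; exact: filt0. Qed.

Lemma filt_lt_sum n (J : finType) (P : pred J) (f : J -> U) :
  (forall j, P j -> filt_lt n (f j)) -> filt_lt n (\sum_(j | P j) f j).
Proof.
by move=> Ff; apply: big_ind => //; [exact: filt_lt0 | exact: filt_lt_add].
Qed.

Lemma filt_ltW n x : filt_lt n x -> filt n x.
Proof. by case: n => [/= ->|n]; [exact: filt0 | exact: filtS]. Qed.

Lemma filt_lt_mulZ n k x : filt_lt n x -> filt_lt n (k *: x).
Proof. by case: n => [/= ->|n]; [rewrite scaler0 | exact: filt_mulZ]. Qed.

Lemma filt_lt_mul n x y : filt_lt n x -> filt 1 y -> filt_lt n.+1 (x * y).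
Proof.
case: n => [/= -> _|n Fx Fy]; first by rewrite mul0r; exact: filt0.
by rewrite /= -addn1; exact: filt_mul.
Qed.

(** Delta(u) - u (x) 1. Only rows of positive index are taken: there the parity operator is trivial,
    and the leading part of Delta(u) is u itself without a sign. *)
Definition delta_red (u : U) i b : U := delta u (ipos i) b - u *+ (ipos i == b).

Lemma delta_redE u i b :
  delta u (ipos i) b = u *+ (ipos i == b) + delta_red u i b.
Proof. by rewrite addrC subrK. Qed.

Lemma delta_redD u v i b : delta_red (u + v) i b = delta_red u i b + delta_red v i b.
Proof. by rewrite /delta_red deltaD mulrnDl opprD addrACA. Qed.

(** A twisted Leibniz rule: the first term differentiates [u], the term in [u] differentiates the
    new factor, and the sum over [d] has lower degree. The sign is the parity operator read off at
    column [b]. *)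
Lemma delta_red_mulF u j c i b :
  delta_red (u * F (ipos j) c) i b =
  (-1) ^+ (ipar b && ipar c) *: (delta_red u i b * F (ipos j) c)
  + (Fmx (ipos j) c (ipos i) b *: u
     + \sum_d Fmx (ipos j) c d b *: delta_red u i d).
Proof.
rewrite {1}/delta_red deltaM.
under eq_bigr do rewrite delta_F ipar_ipos mulrDr mulr_algr addFb.
rewrite big_split /= (bigD1 b) //= eqxx big1 => [|d]; last first.
  by move=> /negbTE->; rewrite mulr0.
rewrite addr0 mulr1n addrAC; congr (_ + _).
  rewrite delta_redE mulrDl -!scalerAr.
  have [<-|_] := eqVneq (ipos i) b.
    by rewrite ipar_ipos !scale1r !mulr1n addrAC subrr add0r.
  by rewrite !mulr0n mul0r scaler0 add0r subr0.
rewrite [in RHS](_ : Fmx _ _ _ _ *: u =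
    \sum_d Fmx (ipos j) c d b *: (u *+ (ipos i == d))).
  by rewrite -big_split; apply: eq_bigr => d _; rewrite delta_redE scalerDr.
rewrite (bigD1 (ipos i)) //= eqxx big1 ?addr0 // => d.
by rewrite eq_sym => /negbTE->; rewrite scaler0.
Qed.

Lemma super_swap (A : algType K) (s : K) (x y z v w : A) : s * s = 1 ->
  s *: (x * y * z) + (v + w) = x * z * y + (v + (s *: (x * (y * z - s *: (z * y))) + w)).
Proof.
move=> ss; rewrite mulrBr scalerBr -scalerAr scalerA ss scale1r !mulrA.
move: (s *: _) (x * z * y) => p q.
by rewrite [p - q]addrC -[in RHS]addrA [X in q + X]addrCA [RHS]addrA subrr add0r addrCA.
Qed.

Lemma delta_red_filt n u i b : filt n u -> filt_lt n (delta_red u i b).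
Proof.
move=> Fu; elim: Fu b => {n u} [n a|n x y _ IHx _ IHy|n x j c Fx IHx] b.
- by rewrite /delta_red delta_scal subrr; exact: filt_lt0.
- by rewrite delta_redD; apply: filt_lt_add.
rewrite delta_red_mulF; apply: filt_lt_add.
  by apply: filt_lt_mulZ; apply: filt_lt_mul => //; exact: filt_F.
apply: filt_add; first exact: filt_mulZ.
by apply: filt_sum => d _; apply: filt_mulZ; exact: filt_ltW.
Qed.

(* Multiplying out the part of Delta(u) that is linear in the second factor
   gives the Euler operator on the associated graded algebra. *)
Definition euler (u : U) : U := \sum_i \sum_b delta_red u i b * F (ipos i) b.

(** Each factor of a monomial, once differentiated and multiplied back on the right, returns the
    monomial up to supercommutators, which lower the degree; n factors give the eigenvalue n. *)
Lemma euler_filt n u : filt n u -> filt_lt n (euler u - u *+ n).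
Proof.
elim=> {u n} [n a|n x y _ IHx _ IHy|n x j c Fx IHx].
- rewrite /euler big1 => [|i _]; last first.
    by rewrite big1 // => b _; rewrite /delta_red delta_scal subrr mul0r.
  case: n => [|n]; first by rewrite subrr.
  by rewrite sub0r -scaleN1r -scaler_nat !scalerA; exact: filt_scal.
- have -> : euler (x + y) = euler x + euler y.
    rewrite -big_split; apply: eq_bigr => i _; rewrite -big_split.
    by apply: eq_bigr => b _; rewrite delta_redD mulrDl.
  by rewrite mulrnDl opprD addrACA; apply: filt_lt_add.
pose s (b : I) : K := (-1) ^+ (ipar b && ipar c).
(* The supercommutator of two generators, of degree 1 instead of 2: moving the new factor past F_ib
   costs only terms of lower degree. *)
pose G i b := F (ipos j) c * F (ipos i) b - s b *: (F (ipos i) b * F (ipos j) c).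
have GE i b : filt 1 (G i b).
  rewrite /G FM !ipar_ipos /= /s [ipar b && _]andbC addrAC subrr add0r.
  rewrite -scaleN1r.
  by do !(apply: filt_mulZ || apply: filt_add || exact: filt_F).
have -> : euler (x * F (ipos j) c) - x * F (ipos j) c *+ n.+1 =
    (euler x - x *+ n) * F (ipos j) c
    + \sum_i \sum_b (s b *: (delta_red x i b * G i b) +
         (\sum_d Fmx (ipos j) c d b *: delta_red x i d) * F (ipos i) b).
  have -> : euler (x * F (ipos j) c) = euler x * F (ipos j) c + (x * F (ipos j) c +
     \sum_i \sum_b (s b *: (delta_red x i b * G i b) +
         (\sum_d Fmx (ipos j) c d b *: delta_red x i d) * F (ipos i) b)).
    (* Differentiating the last factor reproduces it through its expansion on the basis. This extra
       copy of x F_jc turns n into n + 1. *)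
    have xE : x * F (ipos j) c =
        \sum_i \sum_b Fmx (ipos j) c (ipos i) b *: (x * F (ipos i) b).
      rewrite {1}/Defs.F uea_gen_basis F_val mulr_sumr; apply: eq_bigr => i _.
      by rewrite mulr_sumr; apply: eq_bigr => b _; rewrite scalerAr.
    rewrite [X in _ + (X + _)]xE mulr_suml -!big_split /=.
    apply: eq_bigr => i _; rewrite mulr_suml -!big_split /=.
    apply: eq_bigr => b _; rewrite delta_red_mulF [LHS]mulrDl [X in _ + X = _]mulrDl -/(s b).
    move: (delta_red x i b) (\sum_d _) => dx T.
    have ss : s b * s b = 1 by rewrite -expr2 sqrr_sign.
    rewrite -!scalerAl; exact: (super_swap _ _ _ _ _ ss).
  by rewrite mulrBl mulrSr mulrnAl opprD addrACA [X in _ + (X - _)]addrC addrK.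
apply: filt_lt_add; first by apply: filt_lt_mul => //; exact: filt_F.
apply: filt_lt_sum => i _; apply: filt_lt_sum => b _.
have Fd d := delta_red_filt i d Fx.
apply: filt_lt_add.
  by apply: filt_lt_mulZ; exact: filt_lt_mul.
apply: filt_lt_mul; last exact: filt_F.
by apply: filt_lt_sum => d _; apply: filt_lt_mulZ.
Qed.

Hypothesis char0 : forall n, n.+1%:R != 0 :> K.

Lemma filt0_scal u : filt 0 u -> exists a, u = a%:A.
Proof.
move: {-2}0%N (erefl 0%N) => n n0 Fu; elim: Fu n0 => {n u} [n a _|n x y _ IHx _ IHy n0|//].
  by exists a.
have [[a ->] [b ->]] := (IHx n0, IHy n0).
by exists (a + b); rewrite scalerDl.
Qed.

(* If all matrix coefficients of u vanish, so do those of the entries of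
   [delta_red u]; by induction on the degree these are zero, whence [euler u] = 0
   and u has smaller degree. *)
Lemma wcoef_faithful (u : U) :
  (forall n (alpha beta : n.-tuple I), wcoef alpha beta u = 0) -> u = 0.
Proof.
have [n Fu] := filt_exists u; have {Fu} : filt_lt n.+1 u by [].
elim: n.+1 u => {n} [//|n IH] u Fu u0.
have d0 i b : delta_red u i b = 0.
  apply: IH; first exact: delta_red_filt.
  move=> m alpha beta; rewrite /delta_red wcoefB.
  have := u0 _ [tuple of ipos i :: alpha] [tuple of b :: beta] => /= ->.
  by case: eqP => _; rewrite ?u0 ?wcoef0 subrr.
case: n => [|n] in IH Fu *.
  have [a ua] := filt0_scal Fu.
  by have := u0 _ [tuple] [tuple]; rewrite ua wcoef_scal eqxx mulr1 => ->; rewrite scale0r.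
have := euler_filt Fu; rewrite /euler big1 => [|i _]; last first.
  by rewrite big1 // => b _; rewrite d0 mul0r.
rewrite sub0r => /(filt_lt_mulZ (- n.+1%:R^-1)).
rewrite scaleNr scalerN opprK -scaler_nat scalerA mulVf // scale1r.
by move/IH; apply.
Qed.

End Filtration.

(** * Highest weight vectors *)

Import Num.Theory.



(* [iabs a] is |a| - 1, so that it ranges over 'I_N. *)
Definition iabs (N : nat) (a : 'I_(N + N)) : 'I_N :=
  match split a with inl i => i | inr i => i end.

Lemma iabs_ipos N (i : 'I_N) : iabs (ipos i) = i.
Proof. by rewrite /iabs -[ipos i]/(unsplit (inl i)) unsplitK. Qed.

Lemma iabs_ineg N (a : 'I_(N + N)) : iabs (ineg a) = iabs a.
Proof.
rewrite /ineg /iabs; case: (splitP a) => i _.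
  by rewrite -[rshift N i]/(unsplit (inr i)) unsplitK.
by rewrite -[lshift N i]/(unsplit (inl i)) unsplitK.
Qed.

Lemma nplus_entry (K : fieldType) N X (i : 'I_N) b :
  X \in nplus K N -> (iabs b <= i)%N -> X (ipos i) b = 0.
Proof.
move=> Xn le_bi.
suff H (j k : 'I_N) c : (j < k)%N -> iabs c = k -> Fmx K (ipos j) c (ipos i) b = 0.
  case/memv_sumP: Xn => Y HY ->; rewrite summxE big1 // => j _.
  have /memv_sumP[Z HZ ->] := HY j isT; rewrite summxE big1 // => k jk.
  have /memv_addP[_ /vlineP[s ->] [_ /vlineP[t ->] ->]] := HZ k jk.
  rewrite mxE [X in X + _]mxE [X in _ + X]mxE.
  by rewrite !(H j k) ?mulr0 ?addr0 ?iabs_ineg ?iabs_ipos.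
move=> jk ck; rewrite FmxE.
case: andP => [[/eqP/lshift_inj ij /eqP bc]|_].
  by move: le_bi; rewrite bc ck ij leqNgt jk.
case: andP => [[/eqP/(congr1 (@ipar N N))]|_]; last by rewrite addr0.
by rewrite ipar_ineg !ipar_ipos.
Qed.

Lemma nminus_entry (K : fieldType) N X (i : 'I_N) b :
  X \in nminus K N -> (i <= iabs b)%N -> X (ipos i) b = 0.
Proof.
move=> Xn le_bi.
suff H (j k : 'I_N) c : (k < j)%N -> iabs c = k -> Fmx K (ipos j) c (ipos i) b = 0.
  case/memv_sumP: Xn => Y HY ->; rewrite summxE big1 // => j _.
  have /memv_sumP[Z HZ ->] := HY j isT; rewrite summxE big1 // => k jk.
  have /memv_addP[_ /vlineP[s ->] [_ /vlineP[t ->] ->]] := HZ k jk.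
  rewrite mxE [X in X + _]mxE [X in _ + X]mxE.
  by rewrite !(H j k) ?mulr0 ?addr0 ?iabs_ineg ?iabs_ipos.
move=> jk ck; rewrite FmxE.
case: andP => [[/eqP/lshift_inj ij /eqP bc]|_].
  by move: le_bi; rewrite bc ck ij leqNgt jk.
case: andP => [[/eqP/(congr1 (@ipar N N))]|_]; last by rewrite addr0.
by rewrite ipar_ineg !ipar_ipos.
Qed.

Section HighestWeight.
Variables (C : numClosedFieldType) (N : nat).

Local Notation I := 'I_(N + N).
Local Notation U := (Uq C N).
Local Notation Fmx := (@Fmx C N).
Local Notation F := (@F C N).
Local Notation ipos := (@ipos N).

Lemma wcoef_F_adj n (alpha beta : n.-tuple I) a b :
  wcoef beta alpha (F b a) = (wcoef alpha beta (F a b))^*.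
Proof.
elim: n => [|n IH] in alpha beta *.
  by rewrite (tuple0 alpha) (tuple0 beta) !wcoef_F0 rmorph0.
case/tupleP: alpha => c alpha; case/tupleP: beta => d beta.
rewrite [wcoef [tuple of c :: _] _ _]wcoef_F_cons [wcoef [tuple of d :: _] _ _]wcoef_F_cons.
rewrite IH rmorphD !rmorphMn rmorphM rmorph_sign.
rewrite eq_sym [beta == _]eq_sym addbC; congr (_ + _ *+ _).
  by case: eqP => [->|//].
by rewrite !FmxE rmorphD !rmorph_nat ![(d == _) && _]andbC.
Qed.

Section Word.
Variable n : nat.
Local Notation V := {ffun n.-tuple I -> C}.

Definition vscale k (v : V) : V := [ffun alpha : n.-tuple I => k * v alpha].

Definition act (u : U) (v : V) : V :=
  [ffun alpha : n.-tuple I => \sum_(beta : n.-tuple I) wcoef alpha beta u * v beta].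

Lemma actM x y v : act (x * y) v = act x (act y v).
Proof.
apply/ffunP => alpha; rewrite !ffunE.
under eq_bigr do rewrite wcoefM mulr_suml.
rewrite exchange_big; apply: eq_bigr => gamma _.
by rewrite ffunE mulr_sumr; apply: eq_bigr => beta _; rewrite mulrA.
Qed.

Lemma actD x y v : act (x + y) v = act x v + act y v.
Proof.
apply/ffunP => alpha; rewrite !ffunE -big_split.
by apply: eq_bigr => beta _; rewrite wcoefD mulrDl.
Qed.

Lemma actZ k x v : act (k *: x) v = vscale k (act x v).
Proof.
apply/ffunP => alpha; rewrite !ffunE mulr_sumr.
by apply: eq_bigr => beta _; rewrite wcoefZ mulrA.
Qed.

Lemma act0 v : act 0 v = 0.
Proof.
by apply/ffunP => alpha; rewrite !ffunE big1 // => beta _; rewrite wcoef0 mul0r.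
Qed.

Lemma actB x y v : act (x - y) v = act x v - act y v.
Proof.
apply/ffunP => alpha; rewrite !ffunE -sumrB.
by apply: eq_bigr => beta _; rewrite wcoefB mulrBl.
Qed.

Lemma act_sum (J : finType) (P : pred J) (x : J -> U) v :
  act (\sum_(j | P j) x j) v = \sum_(j | P j) act (x j) v.
Proof. by apply: (big_morph (act^~ v)) => [x' y'|]; rewrite ?actD ?act0. Qed.

Lemma actZr x k v : act x (vscale k v) = vscale k (act x v).
Proof.
apply/ffunP => alpha; rewrite !ffunE mulr_sumr.
by apply: eq_bigr => beta _; rewrite ffunE mulrCA.
Qed.

Lemma act0r x : act x 0 = 0.
Proof.
by apply/ffunP => alpha; rewrite !ffunE big1 // => beta _; rewrite ffunE mulr0.
Qed.

Definition dot (v w : V) : C := \sum_alpha v alpha * (w alpha)^*.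

Lemma dotDl v v' w : dot (v + v') w = dot v w + dot v' w.
Proof. by rewrite -big_split; apply: eq_bigr => a _; rewrite ffunE mulrDl. Qed.

Lemma dotZl k v w : dot (vscale k v) w = k * dot v w.
Proof. by rewrite mulr_sumr; apply: eq_bigr => a _; rewrite ffunE mulrA. Qed.

Lemma dot0l w : dot 0 w = 0.
Proof. by rewrite /dot big1 // => a _; rewrite ffunE mul0r. Qed.

Lemma dotBl v v' w : dot (v - v') w = dot v w - dot v' w.
Proof. by rewrite -sumrB; apply: eq_bigr => a _; rewrite !ffunE mulrBl. Qed.

Lemma dot_suml (J : finType) (P : pred J) (v : J -> V) w :
  dot (\sum_(j | P j) v j) w = \sum_(j | P j) dot (v j) w.
Proof. by apply: (big_morph (dot^~ w)) => [x y|]; rewrite ?dotDl ?dot0l. Qed.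

Lemma dotC v w : dot w v = (dot v w)^*.
Proof.
by rewrite rmorph_sum; apply: eq_bigr => a _; rewrite rmorphM /= conjCK mulrC.
Qed.

Lemma dot0r v : dot v 0 = 0.
Proof. by rewrite dotC dot0l rmorph0. Qed.

Lemma dot_eq0 v : dot v v = 0 -> v = 0.
Proof.
move=> v0; apply/ffunP => a; rewrite ffunE; apply/eqP.
have /(_ a isT) := psumr_eq0P (fun a _ => mul_conjC_ge0 (v a)) v0.
by move/eqP; rewrite mul_conjC_eq0.
Qed.

(** The adjoint is taken on the tensor power, not as an antiautomorphism of U: for the generators
    alone, [dot_F] identifies it with the action of another generator. *)
Definition adj (u : U) (v : V) : V :=
  [ffun alpha : n.-tuple I => \sum_(beta : n.-tuple I) (wcoef beta alpha u)^* * v beta].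

Lemma dot_adj u v w : dot (act u v) w = dot v (adj u w).
Proof.
rewrite /dot; under eq_bigr do rewrite ffunE mulr_suml.
rewrite exchange_big; apply: eq_bigr => beta _; rewrite ffunE rmorph_sum mulr_sumr.
apply: eq_bigr => alpha _; rewrite rmorphM /= conjCK.
by rewrite mulrAC mulrC.
Qed.

Lemma dot_F a b v w : dot (act (F a b) v) w = dot v (act (F b a) w).
Proof.
rewrite dot_adj; congr dot; apply/ffunP => alpha; rewrite !ffunE.
by apply: eq_bigr => beta _; rewrite -wcoef_F_adj.
Qed.

Definition hw (w : V) : Prop :=
  forall (i : 'I_N) b, (i < iabs b)%N -> act (F (ipos i) b) w = 0.

Lemma hw_F w a b : hw w -> (iabs a < iabs b)%N -> act (F a b) w = 0.
Proof.
move=> hww; elim/I_ind: a => i; rewrite ?iabs_ineg iabs_ipos; first exact: hww.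
by rewrite -{2}[b]inegK F_ineg -(iabs_ineg b); exact: hww.
Qed.

Lemma hc_kernel_dot z w w' : hc_kernel z -> hw w -> hw w' ->
  dot (act z w) w' = 0.
Proof.
move=> kz hww hww'; elim: kz => [|x y _ IHx _ IHy|x u xn|u x xn].
- by rewrite act0 dot0l.
- by rewrite actD dotDl IHx IHy addr0.
- rewrite actM uea_gen_basis act_sum dot_suml big1 // => i _.
  rewrite act_sum dot_suml big1 // => b _; rewrite actZ dotZl.
  have [le_ib|lt_bi] := leqP i (iabs b).
    by rewrite nminus_entry // mul0r.
  by rewrite dot_F (hw_F hww') ?dot0r ?mulr0 // iabs_ipos.
rewrite actM uea_gen_basis act_sum big1 ?act0r ?dot0l // => i _.
rewrite act_sum big1 // => b _; rewrite actZ.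
have [le_ib|lt_bi] := leqP (iabs b) i.
  by rewrite nplus_entry //; apply/ffunP => alpha; rewrite !ffunE mul0r.
by rewrite hww //; apply/ffunP => alpha; rewrite !ffunE mulr0.
Qed.

(** The measure that ends the search for a highest weight vector: n_+ replaces one letter by a
    letter of smaller absolute value. *)
Definition deg (alpha : seq I) : nat := \sum_(a <- alpha) iabs a.

End Word.

Lemma wcoef_F_deg n (alpha beta : n.-tuple I) a b :
  (iabs a < iabs b)%N -> wcoef alpha beta (F a b) != 0 -> (deg alpha < deg beta)%N.
Proof.
move=> ab; elim: n => [|n IH] in alpha beta *.
  by rewrite (tuple0 alpha) (tuple0 beta) wcoef_F0 eqxx.
case/tupleP: alpha => c alpha; case/tupleP: beta => d beta.
rewrite [wcoef _ _ _]wcoef_F_cons /deg !big_cons -/(deg _) -/(deg _).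
have [<-|_] := eqVneq c d.
  rewrite mulr1n ltn_add2l; have [//|] := boolP (deg alpha < deg beta)%N.
  move=> nlt; have -> : wcoef alpha beta (F a b) = 0.
    by apply: contraNeq nlt; exact: IH.
  rewrite mulr0 add0r FmxE.
  case: andP => [[/eqP-> /eqP ba]|_]; first by rewrite ba ltnn in ab.
  case: andP => [[/eqP ca /eqP cb]|_]; last by rewrite addr0 mul0rn eqxx.
  by rewrite -(inegK a) -(inegK b) -ca -cb ltnn in ab.
rewrite mulr0n add0r; have [->|_] := eqVneq alpha beta; last by rewrite mulr0n eqxx.
rewrite mulr1n ltn_add2r FmxE.
case: andP => [[/eqP-> /eqP->] //|_].
case: andP => [[/eqP-> /eqP->]|_]; first by rewrite !iabs_ineg.
by rewrite addr0 eqxx.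
Qed.

(** If v is not a highest weight vector, some F_ib of n_+ sends it to a nonzero vector, and the
    bound on [deg] over the support drops by one. P stands for membership in a submodule. *)
Lemma hw_exists n (P : {ffun n.-tuple I -> C} -> Prop) v :
  (forall a b w, P w -> P (act (F a b) w)) -> P v -> v != 0 ->
  exists w, [/\ P w, w != 0 & hw w].
Proof.
move=> PF; pose D := (\max_(alpha : n.-tuple I) deg alpha).+1.
have: forall alpha, v alpha != 0 -> (deg alpha < D)%N.
  by move=> alpha _; rewrite ltnS; exact: (leq_bigmax (F := fun t : n.-tuple I => deg t)).
elim: D v => [|D IH] v vD Pv v0.
  by case/negP: v0; apply/eqP/ffunP => a; rewrite ffunE; have [//|/vD] := eqVneq (v a) 0.
have [hwv|] := pselect (hw v); first by exists v.
move/existsNP => [i /existsNP[b /not_implyP[ib /eqP nz]]].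
apply: IH nz => //; last exact: PF.
move=> alpha; rewrite ffunE => nz.
have [//|nlt] := boolP (deg alpha < D)%N; case/negP: nz; apply/eqP/big1 => beta _.
apply/eqP; apply: contraNT nlt; rewrite mulf_eq0 negb_or => /andP[c0 /vD lt].
by apply: leq_trans (lt : (_ <= D)%N); apply: wcoef_F_deg c0; rewrite iabs_ipos.
Qed.

(* Let Z be the operator of z on a tensor power.  If Z is nonzero, its image is
   a nonzero submodule, so it contains a highest weight vector w.  As Z^* w is
   again a highest weight vector, <Z Z^* w, w> = |Z^* w|^2 vanishes, and w, being
   in the image of Z, is orthogonal to itself. *)
Lemma twisted_central_eq0 (e : bool) (z : U) :
  (forall a b, F a b * z = (-1) ^+ (e && (ipar a (+) ipar b)) *: (z * F a b)) ->
  (forall n (w w' : {ffun n.-tuple I -> C}), hw w -> hw w' -> dot (act z w) w' = 0) ->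
  z = 0.
Proof.
move=> zC z0; apply: wcoef_faithful => [n|n alpha beta]; first by rewrite pnatr_eq0.
apply/eqP/negPn/negP => c0.
have [|||w [[v wv] w0 hww]] := @hw_exists n (fun w => exists v, w = act z v)
   (act z [ffun gamma => (gamma == beta)%:R]).
- move=> a b w [v ->]; exists (vscale ((-1) ^+ (e && (ipar a (+) ipar b))) (act (F a b) v)).
  by rewrite -actM zC actZ actZr actM.
- by eexists.
- apply: contra c0 => /eqP/ffunP/(_ alpha); rewrite !ffunE (bigD1 beta) //= ffunE eqxx mulr1.
  rewrite big1 => [|gamma]; last by move=> /negbTE ngb; rewrite ffunE ngb mulr0.
  by rewrite addr0 => ->.
pose u := adj z w.
have hwu : hw u.
  (* With y = F_ib u, the norm of y is up to sign and conjugation the product of z y with F_ib w: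
     F_bi moves across z, then across the form, and F_ib w = 0. *)
  move=> i b ib; apply: dot_eq0; set y := act _ u.
  rewrite {1}/y dot_F dotC -dot_adj -actM.
  set s := (-1) ^+ (e && (ipar b (+) ipar (ipos i))) : C.
  have -> : z * F b (ipos i) = s *: (F b (ipos i) * z).
    by rewrite zC scalerA -expr2 sqrr_sign scale1r.
  by rewrite actZ actM dotZl dot_F hww // dot0r mulr0 rmorph0.
have u0 : u = 0 by apply: dot_eq0; rewrite -dot_adj z0.
by case/eqP: w0; apply: dot_eq0; rewrite {1}wv dot_adj -/u u0 dot0r.
Qed.

End HighestWeight.

(** * Injectivity of the Harish-Chandra map on the centre *)

Section Kernel.
Variables (K : fieldType) (N : nat).

Local Notation I := 'I_(N + N).
Local Notation U := (Uq K N).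
Local Notation Fmx := (@Fmx K N).
Local Notation F := (@F K N).
Local Notation ipos := (@ipos N).

Lemma Fmx_nplus (a b : I) : (iabs a < iabs b)%N -> Fmx a b \in nplus K N.
Proof.
wlog: a b / exists i, a = ipos i => [H|[i ->]].
  move=> ab; elim/I_ind: a ab => i ab; first by apply: H => //; exists i.
  rewrite -[b]inegK Fmx_ineg; apply: H; first by exists i.
  by rewrite iabs_ineg; rewrite iabs_ineg in ab.
rewrite iabs_ipos => ib; apply: (subvP (sumv_sup i isT (sumv_sup (iabs b) ib (subvv _)))).
elim/I_ind: b {ib} => j; rewrite ?iabs_ineg iabs_ipos.
  exact: (subvP (addvSl _ _)) (memv_line _).
exact: (subvP (addvSr _ _)) (memv_line _).
Qed.

Lemma Fmx_nminus (a b : I) : (iabs b < iabs a)%N -> Fmx a b \in nminus K N.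
Proof.
wlog: a b / exists i, a = ipos i => [H|[i ->]].
  move=> ab; elim/I_ind: a ab => i ab; first by apply: H => //; exists i.
  rewrite -[b]inegK Fmx_ineg; apply: H; first by exists i.
  by rewrite iabs_ineg; rewrite iabs_ineg in ab.
rewrite iabs_ipos => ib; apply: (subvP (sumv_sup i isT (sumv_sup (iabs b) ib (subvv _)))).
elim/I_ind: b {ib} => j; rewrite ?iabs_ineg iabs_ipos.
  exact: (subvP (addvSl _ _)) (memv_line _).
exact: (subvP (addvSr _ _)) (memv_line _).
Qed.

Lemma hc_kernelL_F a b u : (iabs b < iabs a)%N -> hc_kernel (F a b * u).
Proof. by move=> ab; apply: hc_kernelL; rewrite F_val Fmx_nminus. Qed.

Lemma hc_kernelR_F a b u : (iabs a < iabs b)%N -> hc_kernel (u * F a b).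
Proof. by move=> ab; apply: hc_kernelR; rewrite F_val Fmx_nplus. Qed.

Lemma hc_kernelZ k (x : U) : hc_kernel x -> hc_kernel (k *: x).
Proof.
elim=> {x} [|x y _ Hx _ Hy|x u xn|u x xn].
- by rewrite scaler0; exact: hc_kernel0.
- by rewrite scalerDr; exact: hc_kernelD.
- by rewrite scalerAr; exact: hc_kernelL.
- by rewrite scalerAl; exact: hc_kernelR.
Qed.

Lemma hc_kernelB (x y : U) : hc_kernel x -> hc_kernel y -> hc_kernel (x - y).
Proof.
by move=> Hx Hy; rewrite -scaleN1r; apply: hc_kernelD => //; exact: hc_kernelZ.
Qed.

Lemma hc_kernel_sum (J : finType) (P : pred J) (f : J -> U) :
  (forall j, P j -> hc_kernel (f j)) -> hc_kernel (\sum_(j | P j) f j).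
Proof.
by move=> Hf; apply: big_ind => //; [exact: hc_kernel0 | exact: hc_kernelD].
Qed.

(** The Cartan part, odd elements F_(i,-i) included, normalizes n_-, so n_- U is stable under it on
    the left; U n_+ is stable under all of U. *)
Lemma hc_kernel_mull_cartan a b x : iabs a = iabs b ->
  hc_kernel x -> hc_kernel (F a b * x).
Proof.
move=> ab; elim=> {x} [|x y _ Hx _ Hy|x u xn|u x xn].
- by rewrite mulr0; exact: hc_kernel0.
- by rewrite mulrDr; exact: hc_kernelD.
- rewrite uea_gen_basis mulr_suml mulr_sumr; apply: hc_kernel_sum => i _.
  rewrite mulr_suml mulr_sumr; apply: hc_kernel_sum => c _.
  rewrite -scalerAl -scalerAr.
  have [le_ic|lt_ci] := leqP i (iabs c).
    by rewrite nminus_entry // scale0r; exact: hc_kernel0.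
  apply: hc_kernelZ; rewrite mulrA FM mulrDl -scalerAl -mulrA.
  have hF a' b' k : (iabs b' < iabs a')%N -> hc_kernel (k *: F a' b' * u).
    by move=> h; rewrite -scalerAl; apply: hc_kernelZ; exact: hc_kernelL_F.
  have hF' a' b' (t : bool) : (t -> (iabs b' < iabs a')%N) -> hc_kernel (t%:R *: F a' b' * u).
    by case: t => [/(_ isT) h|_]; [exact: hF | rewrite scale0r mul0r; exact: hc_kernel0].
  apply: hc_kernelD; first by apply/hc_kernelZ/hc_kernelL_F; rewrite iabs_ipos.
  rewrite mulrBl -scalerAl; apply: hc_kernelB; last apply: hc_kernelZ.
    rewrite mulrDl; apply: hc_kernelD; apply: hF' => /eqP bi.
      by rewrite ab bi iabs_ipos.
    by rewrite iabs_ineg ab bi iabs_ineg iabs_ipos.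
  rewrite mulrDl; apply: hc_kernelD; apply: hF' => /eqP ca.
    by rewrite -ab -ca iabs_ipos.
  by rewrite iabs_ineg -ab -(iabs_ineg a) -ca iabs_ipos.
- by rewrite mulrA; exact: hc_kernelR.
Qed.

Lemma hc_kernel_mulr_central x z : (forall y : U, z * y = y * z) ->
  hc_kernel x -> hc_kernel (x * z).
Proof.
move=> zC; elim=> {x} [|x y _ Hx _ Hy|x u xn|u x xn].
- by rewrite mul0r; exact: hc_kernel0.
- by rewrite mulrDl; exact: hc_kernelD.
- by rewrite -mulrA; exact: hc_kernelL.
- by rewrite -mulrA -zC mulrA; exact: hc_kernelR.
Qed.

Lemma F_diag_comm i j : GRing.comm (F (ipos i) (ipos i)) (F (ipos j) (ipos j)).
Proof.
have ne k l : (ipos k == ineg (ipos l)) = false.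
  by apply/eqP => /(congr1 (@ipar N N)); rewrite ipar_ineg !ipar_ipos.
rewrite /GRing.comm FM !ipar_ipos !ne /= !scale0r !addr0 scale1r.
rewrite scale1r eq_sym; case: eqP => [/lshift_inj->|_]; first by rewrite subrr addr0.
by rewrite !scale0r subrr addr0.
Qed.

Lemma cartan_evalD f g : cartan_eval (f + g) = cartan_eval f + cartan_eval g :> U.
Proof.
rewrite /cartan_eval.
exact: (mmapD (fun i => F (ipos i) (ipos i)) (in_alg U) f g).
Qed.

Lemma cartan_evalZ k f : cartan_eval (k *: f) = k *: (cartan_eval f : U).
Proof.
rewrite /cartan_eval -[RHS]mulr_algl.
exact: (mmapZ (fun i => F (ipos i) (ipos i)) (in_alg U) k f).
Qed.

Lemma cartan_evalB f g : cartan_eval (f - g) = cartan_eval f - cartan_eval g :> U.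
Proof. by rewrite -scaleN1r cartan_evalD cartan_evalZ scaleN1r. Qed.

Lemma cartan_eval0 : cartan_eval 0 = 0 :> U.
Proof. by rewrite -(scale0r 0) cartan_evalZ scale0r. Qed.

Lemma cartan_eval_sum (J : finType) (P : pred J) (f : J -> {mpoly K[N]}) :
  cartan_eval (\sum_(j | P j) f j) = \sum_(j | P j) cartan_eval (f j) :> U.
Proof.
by apply: (big_morph (@cartan_eval K N)) => [x y|]; rewrite ?cartan_evalD ?cartan_eval0.
Qed.

Lemma cartan_eval_mon m :
  cartan_eval 'X_[m] = \prod_(i < N) F (ipos i) (ipos i) ^+ m i :> U.
Proof.
exact: (mmapX (fun i => F (ipos i) (ipos i)) (in_alg U) m).
Qed.

Lemma cartan_eval1 : cartan_eval 1 = 1 :> U.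
Proof.
rewrite -mpolyX0 cartan_eval_mon big1 // => i _.
by rewrite mnm0E expr0.
Qed.

(** Evaluation lands in a noncommutative ring; it is multiplicative because the F_ii commute with
    each other. *)
Lemma cartan_evalM f g : cartan_eval (f * g) = cartan_eval f * cartan_eval g :> U.
Proof.
elim/mpolyind: f => [|c m f _ _ IH]; first by rewrite mul0r cartan_eval0 mul0r.
rewrite mulrDl !cartan_evalD mulrDl {}IH -scalerAl !cartan_evalZ -scalerAl.
congr (_ *: _ + _); elim/mpolyind: g => [|c' m' g _ _ IH].
  by rewrite mulr0 cartan_eval0 mulr0.
rewrite mulrDr !cartan_evalD mulrDr {}IH -scalerAr !cartan_evalZ -scalerAr.
congr (_ *: _ + _); rewrite -mpolyXD !cartan_eval_mon.
under eq_bigr do rewrite mnmDE exprD.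
have C i j k l : GRing.comm (F (ipos i) (ipos i) ^+ k) (F (ipos j) (ipos j) ^+ l).
  by apply: commrX; apply/commr_sym/commrX; exact: F_diag_comm.
elim: (index_enum _) => [|i r IH]; first by rewrite !big_nil mulr1.
rewrite !big_cons IH -!mulrA; congr (_ * _); rewrite !mulrA; congr (_ * _).
by apply: commr_prod => j _; exact: C.
Qed.

Lemma cartan_evalX i : cartan_eval 'X_i = F (ipos i) (ipos i) :> U.
Proof.
exact: etrans (mmapX (fun i => F (ipos i) (ipos i)) (in_alg U) U_(i)) (mmap1U _ i).
Qed.

Lemma hc_kernel_cartan_eval f x : hc_kernel x -> hc_kernel (cartan_eval f * x : U).
Proof.
move=> kx; elim/mpolyind: f => [|c m f _ _ IH].
  by rewrite cartan_eval0 mul0r; exact: hc_kernel0.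
rewrite cartan_evalD mulrDl; apply: hc_kernelD => //.
rewrite cartan_evalZ -scalerAl; apply: hc_kernelZ; rewrite cartan_eval_mon.
elim: (index_enum _) => [|i r IHr]; first by rewrite big_nil mul1r.
rewrite big_cons -mulrA; elim: (m i) => [|k IHk]; first by rewrite mul1r.
by rewrite exprS -mulrA; apply: hc_kernel_mull_cartan.
Qed.

(* The graph of HC on the centre. *)
Definition central_HC (z : U) (f : {mpoly K[N]}) : Prop :=
  (forall y, z * y = y * z) /\ is_HC z f.

Lemma central_HC1 : central_HC 1 1.
Proof.
split=> [y|]; first by rewrite mul1r mulr1.
by rewrite /is_HC cartan_eval1 subrr; exact: hc_kernel0.
Qed.

Lemma central_HCD z w f g :
  central_HC z f -> central_HC w g -> central_HC (z + w) (f + g).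
Proof.
move=> [zC zf] [wC wg]; split=> [y|]; first by rewrite mulrDl mulrDr zC wC.
by rewrite /is_HC cartan_evalD opprD addrACA; exact: hc_kernelD.
Qed.

Lemma central_HCZ k z f : central_HC z f -> central_HC (k *: z) (k *: f).
Proof.
move=> [zC zf]; split=> [y|]; first by rewrite -scalerAl zC scalerAr.
by rewrite /is_HC cartan_evalZ -scalerBr; exact: hc_kernelZ.
Qed.

(** The kernel is not treated as an ideal. In the splitting below, right multiplication by w
    preserves it because w is central, and left multiplication by f(F_11, ..., F_NN) because the
    Cartan part normalizes n_-. *)
Lemma central_HCM z w f g :
  central_HC z f -> central_HC w g -> central_HC (z * w) (f * g).
Proof.
move=> [zC zf] [wC wg]; split=> [y|]; first by rewrite -mulrA wC mulrA zC mulrA.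
rewrite /is_HC cartan_evalM.
have -> : z * w - cartan_eval f * cartan_eval g =
    (z - cartan_eval f) * w + cartan_eval f * (w - cartan_eval g).
  by rewrite mulrBl mulrBr addrA subrK.
by apply: hc_kernelD; [exact: hc_kernel_mulr_central | exact: hc_kernel_cartan_eval].
Qed.

Lemma central_HC0 : central_HC 0 0.
Proof. by have := central_HCZ 0 central_HC1; rewrite !scale0r. Qed.

Lemma central_HCB z w f g :
  central_HC z f -> central_HC w g -> central_HC (z - w) (f - g).
Proof.
by move=> zf /(central_HCZ (-1)); rewrite !scaleN1r; exact: central_HCD.
Qed.

Lemma central_HC_sum (J : finType) (P : pred J) (z : J -> U) f :
  (forall j, P j -> central_HC (z j) (f j)) ->
  central_HC (\sum_(j | P j) z j) (\sum_(j | P j) f j).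
Proof.
by move=> zf; apply: (big_ind2 central_HC) => //; [exact: central_HC0 | move=> *; exact: central_HCD].
Qed.

End Kernel.

Section Injectivity.
Variables (C : numClosedFieldType) (N : nat).

Local Notation I := 'I_(N + N).
Local Notation U := (Uq C N).
Local Notation F := (@F C N).
Local Notation ipos := (@ipos N).

Lemma central_HC_inj (z : U) : central_HC z 0 -> z = 0.
Proof.
move=> [zC kz]; apply: (@twisted_central_eq0 _ _ false) => [a b|n w w'].
  by rewrite scale1r zC.
by move: kz; rewrite /is_HC cartan_eval0 subr0; exact: hc_kernel_dot.
Qed.

(** * Parity on tensor powers and the odd part of a supercentral element *)

Definition wpar (alpha : seq I) : bool := odd (\sum_(a <- alpha) ipar a).

Lemma wpar_cons a alpha : wpar (a :: alpha) = ipar a (+) wpar alpha.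
Proof. by rewrite /wpar big_cons oddD oddb. Qed.

Lemma wcoef_F_par n (alpha beta : n.-tuple I) a b :
  wcoef alpha beta (F a b) != 0 -> wpar alpha (+) wpar beta = ipar a (+) ipar b.
Proof.
elim: n => [|n IH] in alpha beta *.
  by rewrite (tuple0 alpha) (tuple0 beta) wcoef_F0 eqxx.
case/tupleP: alpha => c alpha; case/tupleP: beta => d beta.
rewrite [wcoef _ _ _]wcoef_F_cons !wpar_cons.
have [/andP[/eqP<- /IH<-]|n1] := boolP ((c == d) && (wcoef alpha beta (F a b) != 0)).
  by move=> _; case: (ipar c) (wpar alpha) (wpar beta) => [] [] [].
have [/andP[/eqP<- /Fmx_homog<-]|n2] := boolP ((alpha == beta) && (Fmx C a b c d != 0)).
  by move=> _; case: (ipar c) (ipar d) (wpar alpha) => [] [] [].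
suff -> : ((-1) ^+ (ipar c && (ipar a (+) ipar b)) * wcoef alpha beta (F a b)) *+ (c == d) = 0.
  suff -> : Fmx C a b c d *+ (alpha == beta) = 0 by rewrite addr0 eqxx.
  by case: eqP n2 => //= _; rewrite negbK => /eqP.
by case: eqP n1 => //= _; rewrite negbK => /eqP->; rewrite mulr0.
Qed.

Lemma wcoef_par n (alpha beta : n.-tuple I) p (x : U) : uea_homog p x ->
  wcoef alpha beta x != 0 -> wpar alpha (+) wpar beta = p.
Proof.
move=> hx; elim: hx alpha beta => {p x} [a|p x hx|p x y _ IHx _ IHy|p q x y _ IHx _ IHy] alpha beta.
- rewrite wcoef_scal; have [->|] := eqVneq alpha beta; first by rewrite addbb.
  by rewrite mulr0 eqxx.
- apply: contraNeq => nab; rewrite uea_gen_basis.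
  apply/eqP; apply: (big_ind (fun z => wcoef alpha beta z = 0)); first exact: wcoef0.
    by move=> y z; rewrite wcoefD => -> ->; rewrite addr0.
  move=> i _; apply: (big_ind (fun z => wcoef alpha beta z = 0)); first exact: wcoef0.
    by move=> y z; rewrite wcoefD => -> ->; rewrite addr0.
  move=> b _; rewrite wcoefZ; have [->|/hx hp] := eqVneq (vsval x (ipos i) b) 0.
    by rewrite mul0r.
  have [->|/wcoef_F_par ab] := eqVneq (wcoef alpha beta (F (ipos i) b)) 0.
    by rewrite mulr0.
  by rewrite ab hp eqxx in nab.
- have [x0|/IHx->//] := eqVneq (wcoef alpha beta x) 0.
  by rewrite wcoefD x0 add0r; exact: IHy.
apply: contraNeq => nab; rewrite wcoefM big1 // => gamma _.
have [->|/IHx px] := eqVneq (wcoef alpha gamma x) 0; first by rewrite mul0r.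
have [->|/IHy py] := eqVneq (wcoef gamma beta y) 0; first by rewrite mulr0.
case/negP: nab; rewrite -px -py.
by case: (wpar alpha) (wpar beta) (wpar gamma) => [] [] [].
Qed.

Lemma uea_homog0 p : uea_homog p (0 : U).
Proof.
rewrite -(linear0 (@uea_gen C N N (qN C N))); apply: uea_homog_gen.
by move=> a b; rewrite linear0 mxE eqxx.
Qed.

Lemma F_homog a b : uea_homog (ipar a (+) ipar b) (F a b).
Proof. by apply: uea_homog_gen; rewrite F_val; exact: Fmx_homog. Qed.

Lemma cartan_eval_homog f : uea_homog false (cartan_eval f : U).
Proof.
elim/mpolyind: f => [|c m f _ _ IH]; first by rewrite cartan_eval0; exact: uea_homog0.
rewrite cartan_evalD; apply: uea_homog_add => //.
rewrite cartan_evalZ -mulr_algl; apply: (@uea_homog_mul _ _ _ _ false false).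
  exact: uea_homog_scal.
rewrite cartan_eval_mon; have h1 : uea_homog false (1 : U).
  by rewrite -(scale1r 1); exact: uea_homog_scal.
apply: big_ind => // [x y|i _]; first exact: (@uea_homog_mul _ _ _ _ false false).
elim: (m i) => // k IHk; rewrite exprS.
by have := uea_homog_mul (F_homog (ipos i) (ipos i)) IHk; rewrite addbb.
Qed.

Section Parity.
Variable n : nat.
Local Notation V := {ffun n.-tuple I -> C}.

Definition twist (v : V) : V := [ffun alpha : n.-tuple I => (-1) ^+ wpar alpha * v alpha].

Lemma act_twist p (x : U) v : uea_homog p x ->
  act x (twist v) = vscale ((-1) ^+ p) (twist (act x v)).
Proof.
move=> hx; apply/ffunP => alpha; rewrite !ffunE !mulr_sumr.
apply: eq_bigr => beta _; rewrite !ffunE.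
have [->|/(wcoef_par hx)<-] := eqVneq (wcoef alpha beta x) 0; first by rewrite !mul0r !mulr0.
by case: (wpar alpha) (wpar beta) => [] [];
  rewrite ?(expr0, expr1, mul1r, mulN1r, mulrN, opprK).
Qed.

Lemma dot_twist v w : dot (twist v) (twist w) = dot v w.
Proof.
apply: eq_bigr => alpha _; rewrite !ffunE rmorphM rmorph_sign.
by rewrite mulrACA -expr2 sqrr_sign mul1r.
Qed.

Lemma hw_twist v : hw v -> hw (twist v).
Proof.
move=> hwv i b ib; rewrite (act_twist _ (F_homog _ _)) hwv //.
by apply/ffunP => alpha; rewrite !ffunE !mulr0.
Qed.

End Parity.

(** For highest weight vectors w, w' the product of z w with w' equals that of f w with w'. Applying
    the parity operator to both vectors keeps the contributions of z0 and f and reverses that of the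
    odd part z1, so the latter vanishes and [twisted_central_eq0] gives z1 = 0. The even part
    commutes with everything. *)
Lemma ZN_central_HC (z : U) f : ZN z -> is_HC z f -> central_HC z f.
Proof.
move=> [z0 [z1 [zE h0 h1 zC]]] kz.
suff z10 : z1 = 0.
  split=> // y; elim/Uq_ind: y => [i b|a|x y Hx Hy|x y Hx Hy].
  - by rewrite zE z10 addr0; have [] := zC _ _ (F_homog (ipos i) b).
  - by rewrite mulr_algl mulr_algr.
  - by rewrite mulrDl mulrDr Hx Hy.
  - by rewrite mulrA Hx -mulrA Hy mulrA.
apply: (@twisted_central_eq0 _ _ true) => [a b|n w w' hww hww'].
  have [_ ->] := zC _ _ (F_homog a b).
  by case: (_ (+) _); rewrite ?(expr0, expr1, mul1r, mulN1r, scale1r, scaleN1r, opprK).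
have E v v' : hw v -> hw v' ->
    dot (act z0 v) v' + dot (act z1 v) v' = dot (act (cartan_eval f : U) v) v'.
  move=> hv hv'; have /eqP := hc_kernel_dot kz hv hv'.
  by rewrite actB dotBl subr_eq0 zE actD dotDl => /eqP.
have /eqP := E _ _ _ (hw_twist hww) (hw_twist hww').
rewrite (act_twist _ h0) (act_twist _ h1) (act_twist _ (cartan_eval_homog f)).
rewrite !dotZl !dot_twist -(E _ _ _ hww hww') mul1r mul1r expr1 mulN1r.
rewrite (inj_eq (addrI _)) eq_sym -subr_eq0 opprK -mulr2n mulrn_eq0.
by move/eqP.
Qed.

End Injectivity.

(** * Cyclic elements *)

Section Cyclic.
Variables (K : fieldType) (N : nat).

Local Notation I := 'I_(N + N).
Local Notation U := (Uq K N).
Local Notation F := (@F K N).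
Local Notation ipos := (@ipos N).

(* The terms of c_(r+1) with i_1 = a and the last index replaced by b. *)
Fixpoint cyc (r : nat) (a b : I) : U :=
  if r is r'.+1 then \sum_c (-1) ^+ ipar c *: (F a c * cyc r' c b) else F a b.

Lemma sum_delta (V : lmodType K) (g : I -> V) a :
  \sum_c (c == a)%:R *: g c = g a.
Proof.
rewrite (bigD1 a) //= eqxx scale1r big1 ?addr0 // => c /negbTE->.
by rewrite scale0r.
Qed.

Lemma supercomm_mul (A : algType K) (x y z g h : A) (s t : K) :
  x * y = s *: (y * x) + g -> x * z = t *: (z * x) + h ->
  x * (y * z) = (s * t) *: (y * z * x) + s *: (y * h) + g * z.
Proof.
move=> xy xz; rewrite mulrA xy mulrDl -scalerAl -[y * x * z]mulrA xz mulrDr.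
by rewrite scalerDr -scalerAr scalerA mulrA.
Qed.

Lemma scale_swap2 (V : lmodType K) (k b b' : K) (x y : V) :
  b *: (k *: x) + b' *: (k *: y) = k *: (b *: x + b' *: y).
Proof. by rewrite scalerDr !scalerA mulrC [b' * k]mulrC. Qed.

Lemma supercomm_expand (V : lmodType K) (u s t : K) (x p q y z : V) :
  u *: ((s * t) *: x + s *: (y - t *: z) + (p - s *: q)) =
  (s * t) *: (u *: x) + (u *: p - (s * t) *: (u *: z))
  + ((u * s) *: y - (u * s) *: q).
Proof.
rewrite !scalerDr !scalerN !scalerA -!addrA.
rewrite [u * (s * t)]mulrC -[u * s * t]mulrA [u * (s * t)]mulrC; congr (_ + _).
by rewrite addrCA [RHS]addrCA; congr (_ + _); rewrite addrCA.
Qed.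

(** Entries of a power of F obey the same relation as the generators. The negation stays on [a] in
    the first bracket and on [b] in the second: by [cyc_ineg], moving it to the other index would
    cost a sign depending on r. *)
Lemma F_cyc r a b c d :
  let s : K := (-1) ^+ ((ipar a (+) ipar b) && (ipar c (+) ipar d)) in
  F a b * cyc r c d = s *: (cyc r c d * F a b)
   + ((b == c)%:R *: cyc r a d + (b == ineg c)%:R *: cyc r (ineg a) d
      - s *: ((d == a)%:R *: cyc r c b + (d == ineg a)%:R *: cyc r c (ineg b))).
Proof.
have FN x y : F (ineg x) y = F x (ineg y) by rewrite -F_ineg inegK.
elim: r c d => [|r IH] c d s; first by rewrite /= FN FM.
rewrite /= mulr_sumr.
pose p := ipar a (+) ipar b.
pose t (e : I) : K := (-1) ^+ ipar e * (-1) ^+ (p && (ipar c (+) ipar e)).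
have E e : F a b * ((-1) ^+ ipar e *: (F c e * cyc r e d)) =
    s *: ((-1) ^+ ipar e *: (F c e * cyc r e d * F a b))
    + ((b == c)%:R *: ((-1) ^+ ipar e *: (F a e * cyc r e d))
       + (b == ineg c)%:R *: ((-1) ^+ ipar e *: (F (ineg a) e * cyc r e d))
       - s *: ((d == a)%:R *: ((-1) ^+ ipar e *: (F c e * cyc r e b))
          + (d == ineg a)%:R *: ((-1) ^+ ipar e *: (F c e * cyc r e (ineg b)))))
    + ((e == b)%:R *: (t e *: (F c e * cyc r a d))
       + (e == ineg b)%:R *: (t e *: (F c e * cyc r (ineg a) d))
       - ((e == a)%:R *: (t e *: (F c b * cyc r e d))
          + (e == ineg a)%:R *: (t e *: (F c (ineg b) * cyc r e d)))).
  rewrite -scalerAr (supercomm_mul (FM K a b c e) (IH e d)) -!/p.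
  have -> : s = (-1) ^+ (p && (ipar c (+) ipar e)) * (-1) ^+ (p && (ipar e (+) ipar d)).
    rewrite -signr_addb /s -/p; congr (_ ^+ _).
    by case: (p) (ipar c) (ipar d) (ipar e) => [] [] [] [].
  rewrite !scale_swap2 -/(t e) -supercomm_expand; congr (_ *: (_ + _ *: _ + _)).
    rewrite mulrBr mulrDr -!scalerAr mulrDr -!scalerAr.
    by rewrite (eq_sym b e) -(ineg_eq b e) (eq_sym (ineg b) e).
  by rewrite mulrBl mulrDl -!scalerAl mulrDl -!scalerAl FN.
rewrite (eq_bigr _ (fun e _ => E e)).
rewrite !big_split /= !sumrN -!scaler_sumr !big_split /= -!scaler_sumr !sum_delta.
(* The contractions at the summation index cancel in pairs, e = b against e = a and e = -b against e
   = -a, once their signs are seen to agree. *)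
have [ta tna] : t a = t b /\ t (ineg a) = t (ineg b).
  rewrite /t !ipar_ineg -!signr_addb; split; congr (_ ^+ _).
    by rewrite /p; case: (ipar a) (ipar b) (ipar c) => [] [] [].
  by rewrite /p; case: (ipar a) (ipar b) (ipar c) => [] [] [].
rewrite ta tna subrr addr0 mulr_suml; congr (_ *: _ + _).
by apply: eq_bigr => e _; rewrite scalerAl.
Qed.

Lemma cyc_ineg r a b : cyc r (ineg a) (ineg b) = (-1) ^+ r *: cyc r a b.
Proof.
elim: r a b => [|r IH] a b /=; first by rewrite F_ineg scale1r.
rewrite -big_ineg scaler_sumr; apply: eq_bigr => c _.
rewrite F_ineg IH ipar_ineg -scalerAr !scalerA exprS.
by congr (_ *: _); case: (ipar c); rewrite ?expr0 ?expr1 /=; ring.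
Qed.

Lemma sum_cyc_central r (y : U) : (\sum_c cyc r c c) * y = y * \sum_c cyc r c c.
Proof.
elim/Uq_ind: y => [i b|a|x y Hx Hy|x y Hx Hy].
- have E c : F (ipos i) b * cyc r c c = cyc r c c * F (ipos i) b
      + ((c == b)%:R *: cyc r (ipos i) c
         + (c == ineg b)%:R *: cyc r (ineg (ipos i)) c
         - ((c == ipos i)%:R *: cyc r c b
            + (c == ineg (ipos i))%:R *: cyc r c (ineg b))).
    have := F_cyc r (ipos i) b c c; rewrite /= addbb andbF !scale1r => ->.
    by rewrite (eq_sym b c) -(ineg_eq b c) (eq_sym (ineg b) c).
  rewrite mulr_sumr (eq_bigr _ (fun c _ => E c)) big_split /= -mulr_suml.
  by rewrite sumrB !big_split /= !sum_delta subrr addr0.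
- by rewrite mulr_algl mulr_algr.
- by rewrite mulrDl mulrDr Hx Hy.
- by rewrite mulrA Hx -mulrA Hy mulrA.
Qed.

(** The default value [b] of [nth] is read only at position r + 1, just past the word, where it
    supplies the final index. For b = a it closes the cycle and matches the wrap-around of
    [ordS]. *)
Lemma cyc_tuple r a b : cyc r a b = \sum_(t : r.-tuple I)
  (-1) ^+ (\sum_(x <- t) ipar x) *:
    \prod_(k < r.+1) F (nth b (a :: t) k) (nth b (a :: t) k.+1).
Proof.
elim: r a => [|r IH] a /=.
  rewrite (bigD1 [tuple]) //= big_nil big_ord1 scale1r big1 ?addr0 // => t.
  by case/eqP; exact: tuple0.
rewrite big_tuple_cons; apply: eq_bigr => c _.
rewrite IH mulr_sumr scaler_sumr; apply: eq_bigr => t _.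
rewrite -scalerAr scalerA big_cons exprD; congr (_ *: _).
by rewrite [RHS]big_ord_recl.
Qed.

Lemma cyclic_eltE r : cyclic_elt K N r.+1 = \sum_a cyc r a a.
Proof.
transitivity (\sum_(t : r.+1.-tuple I) (-1) ^+ (\sum_(x <- behead t) ipar x) *:
    \prod_(k < r.+1) F (tnth t k) (tnth t (ordS k))).
  rewrite /cyclic_elt (reindex (fun t : r.+1.-tuple I => [ffun k => tnth t k])) /=.
    apply: eq_bigr => t _; rewrite -mulr_algl.
    have -> : \prod_(k < r.+1) F ([ffun k0 => tnth t k0] k) ([ffun k0 => tnth t k0] (ordS k))
       = \prod_(k < r.+1) F (tnth t k) (tnth t (ordS k)).
      by apply: eq_bigr => k _; rewrite !ffunE.
    congr (_ * _).
    have -> : (\sum_(k < r.+1 | (0 < k)%N) ipar ([ffun k0 => tnth t k0] k) =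
               \sum_(x <- behead t) ipar x)%N.
      case/tupleP: t => a t; rewrite /= big_mkcond big_ord_recl /= add0n big_tuple.
      by apply: eq_bigr => k _; rewrite ffunE tnthS.
    by rewrite -[RHS]/(in_alg U _) rmorphXn rmorphN1.
  exists (fun f : {ffun 'I_r.+1 -> I} => [tuple f k | k < r.+1]) => [t _|f _].
    by apply: eq_from_tnth => k; rewrite tnth_mktuple ffunE.
  by apply/ffunP => k; rewrite ffunE tnth_mktuple.
rewrite big_tuple_cons; apply: eq_bigr => a _; rewrite cyc_tuple.
apply: eq_bigr => t _; congr (_ *: _); apply: eq_bigr => k _.
rewrite !(tnth_nth a) /=; congr F.
have [kr|kr] := ltnP k r; first by rewrite modn_small.
have -> : k = r :> nat by apply/eqP; rewrite eqn_leq kr -ltnS ltn_ord.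
by rewrite modnn /= nth_default // size_tuple.
Qed.

End Cyclic.

(** * Odd cyclic elements modulo the Harish-Chandra kernel *)

Lemma kernel_add4 (V : zmodType) (a b x y z : V) :
  a + (x - y) - (- b + (x + z)) - - (y + z) = a + b.
Proof.
rewrite opprD opprK opprD opprK [X in X + _ = _]addrACA.
by rewrite [x - y + _]addrACA subrr add0r -opprD subrK.
Qed.

Lemma kernel_sub4 (V : zmodType) (a b x y z : V) :
  a + (x - y) - (b + (x - z)) - (z - y) = a - b.
Proof.
rewrite opprD opprB [X in X - _ = _]addrACA.
by rewrite [x - y + _]addrC subrKA addrK.
Qed.

Section CyclicHC.
Variables (K : fieldType) (N : nat).

Local Notation I := 'I_(N + N).
Local Notation U := (Uq K N).
Local Notation F := (@F K N).
Local Notation ipos := (@ipos N).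
Local Notation cyc := (@cyc K N).
Local Notation ce := (@cartan_eval K N).
Local Notation phi i := (F (ipos i) (ineg (ipos i))).
Local Notation "x == y %[ker]" := (hc_kernel (x - y))
  (at level 70, y at next level, format "x  ==  y  %[ker]").

Lemma ker_refl (x : U) : x == x %[ker].
Proof. by rewrite subrr; exact: hc_kernel0. Qed.

Lemma ker_trans (y x z : U) : x == y %[ker] -> y == z %[ker] -> x == z %[ker].
Proof. by move=> xy yz; rewrite -(subrK y x) -addrA; exact: hc_kernelD. Qed.

Lemma ker_add (x x' y y' : U) :
  x == x' %[ker] -> y == y' %[ker] -> x + y == x' + y' %[ker].
Proof. by move=> hx hy; rewrite opprD addrACA; exact: hc_kernelD. Qed.

Lemma ker_sub (x x' y y' : U) :
  x == x' %[ker] -> y == y' %[ker] -> x - y == x' - y' %[ker].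
Proof.
move=> hx hy; rewrite opprD addrACA -opprD.
exact: hc_kernelB.
Qed.

Lemma ker_sum (J : finType) (P : pred J) (f g : J -> U) :
  (forall j, P j -> f j == g j %[ker]) ->
  \sum_(j | P j) f j == \sum_(j | P j) g j %[ker].
Proof. by move=> fg; rewrite -sumrB; exact: hc_kernel_sum. Qed.

Lemma ker_cartan a b (x y : U) : iabs a = iabs b ->
  x == y %[ker] -> F a b * x == F a b * y %[ker].
Proof. by move=> ab xy; rewrite -mulrBr; exact: hc_kernel_mull_cartan. Qed.

Lemma ipos_ineg (i j : 'I_N) : (ipos i == ineg (ipos j)) = false.
Proof. by apply/eqP => /(congr1 (@ipar N N)); rewrite ipar_ineg !ipar_ipos. Qed.

(* The omitted terms F a c * cyc r c i, with |c| < |i|, lie in n_- U. *)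
Lemma cyc_recl r i a : iabs a = i ->
  cyc r.+1 a (ipos i) ==
    F a (ipos i) * cyc r (ipos i) (ipos i)
    - F a (ineg (ipos i)) * cyc r (ineg (ipos i)) (ipos i)
    + \sum_(k < N | (i < k)%N)
        (F a (ipos k) * cyc r (ipos k) (ipos i)
         - F a (ineg (ipos k)) * cyc r (ineg (ipos k)) (ipos i)) %[ker].
Proof.
move=> ai; rewrite /= big_I (bigD1 i) //=.
rewrite ipar_ipos ipar_ineg ipar_ipos scale1r expr1 scaleN1r.
apply: ker_add; first exact: ker_refl.
rewrite (bigID (fun k : 'I_N => (i < k)%N)) /= -[X in _ == X %[ker]]addr0.
apply: ker_add.
  rewrite (eq_bigl (fun k : 'I_N => (i < k)%N)) => [|k]; last first.
    by rewrite andb_idl // => ik; apply: contraTneq ik => ->; rewrite ltnn.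
  apply: ker_sum => k _; rewrite ipar_ineg ipar_ipos scale1r expr1 scaleN1r.
  exact: ker_refl.
rewrite subr0; apply: hc_kernel_sum => k /andP[nki]; rewrite -leqNgt => le_ki.
have lt_ki : (k < i)%N by rewrite ltn_neqAle le_ki andbT.
by apply: hc_kernelD; apply: hc_kernelZ; apply: hc_kernelL_F; rewrite ?iabs_ineg iabs_ipos ai.
Qed.

(** In [cyc_recl] the factors F_(i,k) and F_(i,-k) with k > i lie in n_+. Moving them to the right
    by [F_cyc] leaves two copies of the (i, i) entry, which cancel each other, and the entries at
    (k, k) and (-k, -k). *)
Lemma cyc_diag r i :
  cyc r.+1 (ipos i) (ipos i) ==
    F (ipos i) (ipos i) * cyc r (ipos i) (ipos i)
    - phi i * cyc r (ineg (ipos i)) (ipos i)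
    - \sum_(k < N | (i < k)%N)
        (cyc r (ipos k) (ipos k) + cyc r (ineg (ipos k)) (ineg (ipos k))) %[ker].
Proof.
apply: ker_trans (cyc_recl r (iabs_ipos i)) _.
apply: ker_add; first exact: ker_refl.
rewrite -sumrN; apply: ker_sum => k ik; rewrite !F_cyc.
rewrite !ipar_ineg !ipar_ipos /= !ineg_eq !inegK !ipos_ineg !eqxx.
have nik : (ipos i == ipos k) = false.
  by apply/eqP => /lshift_inj e; rewrite e ltnn in ik.
rewrite expr0 expr1 !scaleN1r !scale1r !scale0r !addr0 opprK.
set A := _ * F _ (ipos k); set B := _ * F _ (ineg (ipos k)).
set x := cyc r (ipos i) _; set y := cyc r (ipos k) _; set z := cyc r (ineg _) _.
have -> : A + (x - y) - (- B + (x + z)) - - (y + z) = A + B.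
  exact: kernel_add4.
by apply: hc_kernelD; apply: hc_kernelR_F; rewrite ?iabs_ineg !iabs_ipos.
Qed.

Lemma cyc_antidiag r i :
  cyc r.+1 (ineg (ipos i)) (ipos i) ==
    phi i * cyc r (ipos i) (ipos i)
    - F (ipos i) (ipos i) * cyc r (ineg (ipos i)) (ipos i)
    + \sum_(k < N | (i < k)%N)
        (cyc r (ineg (ipos k)) (ipos k) - cyc r (ipos k) (ineg (ipos k))) %[ker].
Proof.
have := cyc_recl r (etrans (iabs_ineg _) (iabs_ipos i)).
have -> : F (ineg (ipos i)) (ipos i) = phi i by rewrite -F_ineg inegK.
rewrite F_ineg => h; apply: ker_trans h _.
apply: ker_add; first exact: ker_refl.
apply: ker_sum => k ik; rewrite !F_cyc.
rewrite !ipar_ineg !ipar_ipos /= !ineg_eq !inegK !ipos_ineg !eqxx.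
have nik : (ipos i == ipos k) = false.
  by apply/eqP => /lshift_inj e; rewrite e ltnn in ik.
rewrite expr0 !scale1r !scale0r !addr0 !add0r.
set A := _ * F _ (ipos k); set B := _ * F _ (ineg (ipos k)).
set x := cyc r _ (ipos i); set y := cyc r (ipos k) _; set z := cyc r (ineg _) _.
have -> : A + (x - y) - (B + (x - z)) - (z - y) = A - B.
  exact: kernel_sub4.
by apply: hc_kernelB; apply: hc_kernelR_F; rewrite ?iabs_ineg !iabs_ipos.
Qed.

(* By [cyc_hc], HC of the (i, i) entry of the (2s+1)-st power is X_i cyc_poly s i. *)
Fixpoint cyc_poly (s : nat) (i : 'I_N) : {mpoly K[N]} :=
  if s is s'.+1 then
    'X_i * ('X_i * cyc_poly s' i) - 'X_i * cyc_poly s' i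
    - 2%:R *: \sum_(k < N | (i < k)%N) 'X_k * cyc_poly s' k
  else 1.

Hypothesis two_neq0 : 2%:R != 0 :> K.

Lemma phi_sqr i : phi i * phi i = F (ipos i) (ipos i).
Proof.
have h := FM K (ipos i) (ineg (ipos i)) (ipos i) (ineg (ipos i)).
rewrite !ipar_ineg !ipar_ipos /= expr1 !ineg_eq !inegK !ipos_ineg !eqxx in h.
rewrite !scale0r !add0r !scale1r !scaleN1r opprK in h.
have {}h : 2%:R *: (phi i * phi i) = 2%:R *: F (ipos i) (ipos i).
  by rewrite !scaler_nat !mulr2n {1}h addrAC addNr add0r.
by rewrite -[LHS]scale1r -(mulVf two_neq0) -scalerA h scalerA mulVf // scale1r.
Qed.

Lemma phi_comm i : F (ipos i) (ipos i) * phi i = phi i * F (ipos i) (ipos i).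
Proof.
rewrite FM !ipar_ineg !ipar_ipos /= !ineg_eq !ipos_ineg !eqxx.
by rewrite expr0 !scale0r !addr0 add0r inegK eqxx !scale1r subrr addr0.
Qed.

Lemma cyc_neg_neg r k : ~~ odd r ->
  cyc r (ineg (ipos k)) (ineg (ipos k)) = cyc r (ipos k) (ipos k).
Proof. by move=> r_even; rewrite cyc_ineg -signr_odd (negPf r_even) scale1r. Qed.

Lemma cyc_pos_neg r k :
  cyc r (ipos k) (ineg (ipos k)) = (-1) ^+ odd r *: cyc r (ineg (ipos k)) (ipos k).
Proof. by rewrite -{1}(inegK (ipos k)) cyc_ineg signr_odd. Qed.

(** Entries (i, i) and (-i, i) are carried together, as each recursion involves both. One step of s
    passes through an even power of F, where the (-i, i) entry vanishes modulo the kernel ([O2]) and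
    the (k, k) and (-k, -k) entries are opposite. The odd [phi i] is kept as a left factor and
    re-enters the polynomials through its square F_ii. *)
Lemma cyc_hc s i :
  (cyc s.*2 (ipos i) (ipos i) == ce ('X_i * cyc_poly s i) %[ker]) /\
  (cyc s.*2 (ineg (ipos i)) (ipos i) == phi i * ce (cyc_poly s i) %[ker]).
Proof.
have absN k : iabs (ipos k) = iabs (ineg (ipos k)) :> 'I_N by rewrite iabs_ineg.
elim: s i => [|s IH] i.
  have -> : phi i = F (ineg (ipos i)) (ipos i) by rewrite -F_ineg inegK.
  rewrite /= mulr1 cartan_evalX cartan_eval1 mulr1.
  by split; exact: ker_refl.
have r_even : ~~ odd s.*2 by rewrite odd_double.
have O1 k : cyc s.*2.+1 (ipos k) (ipos k) == ce (cyc_poly s.+1 k) %[ker].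
  apply: ker_trans (cyc_diag _ _) _; have [x y] := IH k.
  rewrite /= !cartan_evalB cartan_evalZ.
  apply: ker_sub; first apply: ker_sub.
  - by rewrite cartan_evalM cartan_evalX; exact: ker_cartan.
  - rewrite cartan_evalM cartan_evalX -phi_sqr -mulrA.
    exact: ker_cartan.
  rewrite cartan_eval_sum scaler_sumr; apply: ker_sum => l _.
  rewrite cyc_neg_neg // scaler_nat mulr2n; have [xl _] := IH l.
  exact: ker_add.
have O2 k : hc_kernel (cyc s.*2.+1 (ineg (ipos k)) (ipos k)).
  rewrite -[X in hc_kernel X]subr0; apply: ker_trans (cyc_antidiag _ _) _.
  rewrite big1 => [|l _]; last by rewrite cyc_pos_neg (negPf r_even) scale1r subrr.
  have [x y] := IH k; rewrite addr0.
  have -> : 0 = phi k * ce ('X_k * cyc_poly s k)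
              - F (ipos k) (ipos k) * (phi k * ce (cyc_poly s k)).
    by rewrite cartan_evalM cartan_evalX !mulrA phi_comm subrr.
  by apply: ker_sub; apply: ker_cartan.
split.
  apply: ker_trans (cyc_diag _ _) _.
  rewrite -[ce _]subr0 -[ce _ - 0]subr0; apply: ker_sub; first apply: ker_sub.
  - by rewrite cartan_evalM cartan_evalX; exact: ker_cartan.
  - by rewrite subr0; exact: hc_kernel_mull_cartan.
  rewrite subr0 big1 => [|l _]; first exact: hc_kernel0.
  by rewrite cyc_ineg exprS -signr_odd (negPf r_even) mulr1 scaleN1r subrr.
apply: ker_trans (cyc_antidiag _ _) _.
rewrite -[phi i * ce _]subr0 -[phi i * _ - 0]addr0; apply: ker_add; first apply: ker_sub.
- exact: ker_cartan.
- by rewrite subr0; exact: hc_kernel_mull_cartan.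
rewrite subr0; apply: hc_kernel_sum => l _.
rewrite cyc_pos_neg /= r_even expr1 scaleN1r opprK.
by apply: hc_kernelD; exact: O2.
Qed.

Lemma cyclic_elt_HC s :
  central_HC (cyclic_elt K N s.*2.+1) (2%:R *: \sum_(i < N) 'X_i * cyc_poly s i).
Proof.
split=> [y|]; first by rewrite cyclic_eltE; exact: sum_cyc_central.
rewrite /is_HC cyclic_eltE big_I cartan_evalZ cartan_eval_sum scaler_sumr.
apply: ker_sum => i _; have [x _] := cyc_hc s i.
by rewrite cyc_neg_neg ?odd_double // scaler_nat mulr2n; exact: ker_add.
Qed.

End CyclicHC.

(** * The ring of formal series *)

Section SeriesRing.
Variable A : nzRingType.
Implicit Types f g h : series A.

Definition sadd f g : series A := fun n => f n + g n.
Definition sopp f : series A := fun n => - f n.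

HB.instance Definition _ := gen_eqMixin (series A).
HB.instance Definition _ := gen_choiceMixin (series A).

Lemma saddA : associative sadd.
Proof. by move=> f g h; apply/funext => n; rewrite /sadd addrA. Qed.
Lemma saddC : commutative sadd.
Proof. by move=> f g; apply/funext => n; rewrite /sadd addrC. Qed.
Lemma sadd0 : left_id (fun=> 0 : A) sadd.
Proof. by move=> f; apply/funext => n; rewrite /sadd add0r. Qed.
Lemma saddN : left_inverse (fun=> 0 : A) sopp sadd.
Proof. by move=> f; apply/funext => n; rewrite /sadd addNr. Qed.

HB.instance Definition _ :=
  GRing.isZmodule.Build (series A) saddA saddC sadd0 saddN.

(** A coefficient of a product sees only truncations, so associativity and commutativity of series
    are inherited from polynomials. *)
Lemma smul_poly f g n m : (n < m)%N ->
  smul f g n = ((\poly_(i < m) f i) * (\poly_(i < m) g i))`_n.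
Proof.
move=> nm; rewrite coefM; apply: eq_bigr => i _; rewrite !coef_poly.
by rewrite !(leq_ltn_trans _ nm) ?leq_subr // -ltnS.
Qed.

Lemma smul_eq n f f' g g' :
  (forall m, (m <= n)%N -> f m = f' m) -> (forall m, (m <= n)%N -> g m = g' m) ->
  smul f g n = smul f' g' n.
Proof.
move=> ff gg; apply: eq_bigr => i _.
have lin : (i <= n)%N by rewrite -ltnS.
by rewrite (ff _ lin) (gg _ (leq_subr _ _)).
Qed.

Lemma smulA : associative (@smul A).
Proof.
move=> f g h; apply/funext => n.
rewrite (@smul_eq n f f _ (fun i => (\poly_(i < n.+1) g i * \poly_(i < n.+1) h i)`_i)) //; last first.
  by move=> m mn; rewrite (@smul_poly _ _ _ n.+1).
rewrite [RHS](@smul_eq n _ (fun i => (\poly_(i < n.+1) f i * \poly_(i < n.+1) g i)`_i) _ h) //; last first.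
  by move=> m mn; rewrite (@smul_poly _ _ _ n.+1).
transitivity ((\poly_(i < n.+1) f i * \poly_(i < n.+1) g i * \poly_(i < n.+1) h i)`_n).
  rewrite -mulrA coefM; apply: eq_bigr => i _; rewrite coef_poly.
  by rewrite ltn_ord.
rewrite coefM; apply: eq_bigr => i _; rewrite [(\poly_(_ < _) h _)`_ _]coef_poly.
by rewrite ltnS leq_subr.
Qed.

Lemma smul1l : left_id (sone A) (@smul A).
Proof.
move=> f; apply/funext => n; rewrite /smul big_ord_recl big1 => [|i _].
  by rewrite mul1r addr0 subn0.
by rewrite mul0r.
Qed.

Lemma smul1r : right_id (sone A) (@smul A).
Proof.
move=> f; apply/funext => n; rewrite /smul big_ord_recr big1 => [|i _] /=.
  by rewrite /sone subnn mulr1 add0r.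
by rewrite /sone subn_eq0 leqNgt ltn_ord mulr0.
Qed.

Lemma smulDl : left_distributive (@smul A) +%R.
Proof.
move=> f g h; apply/funext => n; rewrite -[RHS]/(smul f h n + smul g h n).
by rewrite -big_split; apply: eq_bigr => i _; rewrite /= -mulrDl.
Qed.

Lemma smulDr : right_distributive (@smul A) +%R.
Proof.
move=> f g h; apply/funext => n; rewrite -[RHS]/(smul f g n + smul f h n).
by rewrite -big_split; apply: eq_bigr => i _; rewrite /= -mulrDr.
Qed.

Lemma sone_neq0 : sone A != 0.
Proof. by apply/eqP => /(congr1 (@^~ 0%N))/eqP; rewrite oner_eq0. Qed.

HB.instance Definition _ := GRing.Zmodule_isNzRing.Build (series A)
  smulA smul1l smul1r smulDl smulDr sone_neq0.

Lemma coefs_add f g n : (f + g) n = f n + g n. Proof. by []. Qed.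
Lemma coefs_opp f n : (- f) n = - f n. Proof. by []. Qed.
Lemma coefs_sum (J : Type) (r : seq J) (P : pred J) (F : J -> series A) n :
  (\sum_(j <- r | P j) F j) n = \sum_(j <- r | P j) F j n.
Proof. by apply: (big_morph (@^~ n)). Qed.

Lemma spowE f k : spow f k = f ^+ k.
Proof. by elim: k => // k IH; rewrite exprS -IH. Qed.

(* f has order at least k in u^-1. *)
Definition sord (k : nat) f : Prop := forall n, (n < k)%N -> f n = 0.

Lemma sordM k l f g : sord k f -> sord l g -> sord (k + l) (f * g).
Proof.
move=> fk gl n nkl; rewrite -[(f * g) n]/(smul f g n) /smul big1 // => i _.
have [ik|ki] := ltnP i k; first by rewrite fk // mul0r.
by rewrite gl ?mulr0 // ltn_subLR ?(leq_trans nkl) ?leq_add2r // -ltnS.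
Qed.

Lemma sordX f k : sord 1 f -> sord k (f ^+ k).
Proof.
move=> f1; elim: k => [|k IH]; first by [].
by rewrite exprS; apply: (sordM f1).
Qed.

Lemma sordMl k f g : sord k f -> sord k (f * g).
Proof. by move=> fk; rewrite -[k]addn0; apply: sordM. Qed.

Lemma ssum_trunc (s : nat -> series A) n m : (forall r, sord r (s r)) ->
  (m < n)%N -> ssum s m = (\sum_(r < n) s r) m.
Proof.
move=> so mn; rewrite coefs_sum -(big_mkord xpredT (fun r => s r m)).
rewrite (big_cat_nat (n := m.+1)) //= big_mkord.
rewrite [X in _ + X]big_nat_cond [X in _ + X]big1 ?addr0 // => r.
by move=> /andP[/andP[mr _] _]; exact: so.
Qed.

(** Geometric series: f times the truncated sum of the (1 - f)^r is 1 - (1 - f)^(n+1), and the last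
    power has no coefficient up to n. *)
Lemma smul_sinv f : f 0%N = 1 -> f * sinv f = 1.
Proof.
move=> f0; pose g := 1 - f.
have go r : sord r (g ^+ r).
  by apply: sordX => -[|//] _; rewrite -[g 0%N]/(1 - f 0%N) f0 subrr.
apply/funext => n; rewrite -[LHS]/(smul f _ n).
rewrite (@smul_eq n f f _ (\sum_(r < n.+1) g ^+ r)) //; last first.
  move=> m mn; rewrite -ssum_trunc //; rewrite /sinv /ssum.
  by apply: eq_bigr => r _; rewrite spowE.
have -> : f = - (g - 1) by rewrite opprB /g opprB addrC subrK.
rewrite -[LHS]/((- (g - 1) * \sum_(r < n.+1) g ^+ r) n) mulNr -subrX1 opprB.
by rewrite coefs_add coefs_opp go // subr0.
Qed.

End SeriesRing.

(** * Partial fractions *)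

Section Constants.
Variable A : nzRingType.

Definition cst (a : A) : series A := fun n => a *+ (n == 0%N).

Lemma coefs_cstM a (f : series A) n : (cst a * f) n = a * f n.
Proof.
rewrite -[LHS]/(smul _ f n) /smul big_ord_recl big1 ?addr0 ?subn0 // => i _.
by rewrite mul0r.
Qed.

Lemma cst_is_zmod_morphism : zmod_morphism cst.
Proof. by move=> a b; apply/funext => n; rewrite /cst mulrnBl. Qed.

Lemma cst_is_monoid_morphism : monoid_morphism cst.
Proof.
split=> [|a b]; apply/funext => n; first by [].
by rewrite coefs_cstM /cst mulrnAr.
Qed.

HB.instance Definition _ := GRing.isZmodMorphism.Build A (series A) cst cst_is_zmod_morphism.
HB.instance Definition _ := GRing.isMonoidMorphism.Build A (series A) cst cst_is_monoid_morphism.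

Local Notation T := (uinv (0 : A)).

Lemma coefs_TM (f : series A) n : (T * f) n = if n is m.+1 then f m else 0.
Proof.
rewrite -[LHS]/(smul _ f n) /smul big_ord_recl mul0r add0r.
case: n => [|n]; first by rewrite big_ord0.
rewrite big_ord_recl /= mul1r subn1 big1 ?addr0 // => i _.
by rewrite /= expr0n mul0r.
Qed.

Lemma T_reg (f : series A) : T * f = 0 -> f = 0.
Proof.
move=> Tf; apply/funext => n; have := coefs_TM f n.+1.
by rewrite Tf.
Qed.

Lemma uinv_fix a : uinv a = T * (1 + cst a * uinv a).
Proof.
apply/funext => n; rewrite coefs_TM; case: n => // n.
rewrite coefs_add coefs_cstM; case: n => [|n] /=; first by rewrite mulr0 addr0.
by rewrite -exprS [X in X + _](_ : _ = 0) ?add0r.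
Qed.

End Constants.

(** With t = 1/u, x = 1/(u - a), y = 1/(u - b) this is the resolvent identity multiplied by t. It
    follows from the fixed-point equations without division, and [T_reg] removes the factor t. *)
Lemma resolvent_aux (R : comNzRingType) (t x y a b : R) :
  x = t * (1 + a * x) -> y = t * (1 + b * y) ->
  t * (x - y - (a - b) * x * y) = 0.
Proof.
move=> ex ey; suff -> : t * (x - y - (a - b) * x * y) =
   x * (t * (1 + b * y)) - y * (t * (1 + a * x)).
  by rewrite -ey -ex mulrC subrr.
ring.
Qed.

Section ComSeries.
Variable A : comNzRingType.

Lemma smulC : commutative (@smul A).
Proof.
move=> f g; apply/funext => n; rewrite !(@smul_poly _ _ _ n n.+1) //.
by rewrite mulrC.
Qed.

HB.instance Definition _ := GRing.PzRing_hasCommutativeMul.Build (series A) smulC.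

Lemma uinvB (a b : A) : uinv a - uinv b = cst (a - b) * uinv a * uinv b.
Proof.
apply/eqP; rewrite -subr_eq0; apply/eqP/T_reg; rewrite rmorphB.
exact: resolvent_aux (uinv_fix a) (uinv_fix b).
Qed.

End ComSeries.

Lemma partial_fractions_aux (S : comNzRingType) (x y e vi vj ai b : S) :
  (y - x) * e = 1 -> vj - vi = (y - x) * vj * vi ->
  ai * vi + b * y * vj * (ai * vi) =
  b * y * (ai * e) * vj + ai * (1 - b * y * e) * vi.
Proof.
move=> ye vv; have {}vv : vj * vi = e * (vj - vi).
  by rewrite vv -[LHS]mul1r -ye; ring.
rewrite [_ * (ai * vi)](_ : _ = b * y * ai * (vj * vi)); last by ring.
rewrite vv; ring.
Qed.

(* With c = identity and v i = 1 / (t - lam i) this is the partial fraction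
   expansion of \prod (t + lam i) / (t - lam i); the induction step uses it at
   t = lam j, which is why S and v are quantified inside the induction. *)
Lemma partial_fractions (L : fieldType) (J : eqType) (lam : J -> L) (s : seq J) :
  uniq s -> {in s &, injective lam} ->
  forall (S : comNzRingType) (c : {rmorphism L -> S}) (v : J -> S),
  (forall i j, i \in s -> j \in s -> v i - v j = c (lam i - lam j) * v i * v j) ->
  \prod_(i <- s) (1 + c (2%:R * lam i) * v i) =
  1 + \sum_(i <- s) c (2%:R * lam i *
        \prod_(j <- s | j != i) ((lam i + lam j) / (lam i - lam j))) * v i.
Proof.
elim: s => [|j s IH] /= => [_ _ S c v _|/andP[js us] inj S c v vP].
  by rewrite !big_nil addr0.
have injs : {in s &, injective lam}.
  by move=> i k si sk; apply: inj; rewrite inE ?si ?sk orbT.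
have nz i : i \in s -> lam j - lam i != 0.
  move=> si; rewrite subr_eq0; apply: contraNneq js => /inj ->//.
    by rewrite inE eqxx.
  by rewrite inE si orbT.
rewrite !big_cons (IH us injs S c v) => [|i k si sk]; last first.
  by apply: vP; rewrite inE ?si ?sk orbT.
rewrite eqxx /=.
pose a i := 2%:R * lam i * \prod_(k <- s | k != i) ((lam i + lam k) / (lam i - lam k)).
have Aj : \prod_(i <- s | i != j) ((lam j + lam i) / (lam j - lam i)) =
    1 + \sum_(i <- s) a i / (lam j - lam i).
  rewrite -[RHS](IH us injs L (idfun : {rmorphism L -> L}) (fun i => (lam j - lam i)^-1)).
    rewrite big_seq_cond [RHS]big_seq; apply: eq_big => i.
      by apply: andb_idr => si; apply: contraNneq js => <-.
    by case/andP=> /nz d0 _; rewrite /=; field.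
  by move=> i k /nz di /nz dk /=; field; rewrite di dk.
rewrite Aj [c (_ * (1 + _))]rmorphM [c (1 + _)]rmorphD rmorph1 [c (\sum_(i <- _) _)]rmorph_sum.
rewrite [LHS](_ : _ = 1 + (c (2%:R * lam j) * v j + (\sum_(i <- s) c (a i) * v i
    + c (2%:R * lam j) * v j * \sum_(i <- s) c (a i) * v i))); last by rewrite /a; ring.
congr (1 + _); rewrite mulrDr mulr1 mulrDl -[RHS]addrA.
congr (_ + _); rewrite !mulr_sumr !mulr_suml -!big_split /=.
rewrite big_seq [RHS]big_seq; apply: eq_bigr => i si.
have d0 := nz _ si; rewrite big_cons.
have -> : (j != i) by apply: contraNneq js => ->.
rewrite -/(a i).
have -> : 2 * lam i * ((lam i + lam j) / (lam i - lam j) *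
    \prod_(k <- s | k != i) ((lam i + lam k) / (lam i - lam k)))
    = a i * (1 - 2%:R * lam j * (lam j - lam i)^-1).
  rewrite /a; move: (\prod_(k <- s | _) _) => p; field.
  by rewrite d0 /= -opprB oppr_eq0.
have := vP j i; rewrite !inE eqxx si orbT => /(_ isT isT).
have : c (lam j - lam i) * c ((lam j - lam i)^-1) = 1 by rewrite -rmorphM divff // rmorph1.
rewrite !rmorphM !rmorphB !rmorphM rmorph1; move: (c _^-1) => e.
move: (c (lam j)) (c (lam i)) (v i) (v j) (c (a i)) (c 2) => y x vi vj ai two.
exact: partial_fractions_aux.
Qed.

(** * Generating functions *)

Lemma telescope_aux (R : comNzRingType) (v w d f c g : R) :
  v - w = d * v * w ->
  c * v - f * v * g + f * (g * w) = c * v - f * d * v * (g * w).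
Proof.
move=> vw; have -> : f * d * v * (g * w) = f * g * (d * v * w) by ring.
rewrite -vw; ring.
Qed.

Section FallingFactorials.
Variable A : comNzRingType.
Implicit Types a l : A.

Definition ffactr l r : A := \prod_(k < r) (l - k%:R).

Lemma uinv_ffactE a r : uinv_ffact a r = \prod_(k < r) (uinv (a + k%:R) : series A).
Proof. by []. Qed.

Lemma uinv_ffactS a r :
  uinv_ffact a r.+1 = (uinv_ffact a r : series A) * uinv (a + r%:R).
Proof. by rewrite !uinv_ffactE big_ord_recr. Qed.

Lemma sord_uinv a : sord 1 (uinv a).
Proof. by case. Qed.

Lemma sord_uinv_ffact a r : sord r (uinv_ffact a r).
Proof.
elim: r => [|r IH]; first by [].
by rewrite uinv_ffactS -addn1; apply: sordM => //; exact: sord_uinv.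
Qed.

Lemma sord_cstM k a (f : series A) : sord k f -> sord k (cst a * f).
Proof. by move=> fk n nk; rewrite coefs_cstM fk // mulr0. Qed.

(* (u-a+1)/(u-a+1-l) = sum_r (l \downarrow r)/(u-a \downarrow r), with the
   remainder of the partial sums. *)
Lemma ffactr_sum a l m :
  \sum_(r < m) cst (ffactr l r.+1) * uinv_ffact a r.+1 =
  cst l * uinv (a - 1 + l)
  - cst (ffactr l m.+1) * uinv (a - 1 + l) * uinv_ffact a m :> series A.
Proof.
elim: m => [|m IH].
  have -> : ffactr l 1 = l by rewrite /ffactr big_ord1 subr0.
  by rewrite uinv_ffactE !big_ord0 mulr1 subrr.
rewrite big_ord_recr /= {}IH [ffactr l m.+2]big_ord_recr /= -/(ffactr l m.+1).
rewrite !uinv_ffactS rmorphM.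
have := uinvB (a - 1 + l) (a + m%:R).
have -> : a - 1 + l - (a + m%:R) = l - m.+1%:R by rewrite -natr1; ring.
exact: telescope_aux.
Qed.

End FallingFactorials.

Section GeneratingFunctions.
Variables (L : fieldType) (N : nat) (lam : 'I_N -> L).
Hypothesis lam_inj : injective lam.

Definition schurQ_coef i : L :=
  \prod_(j < N | j != i) ((lam i + lam j) / (lam i - lam j)).

(** Each factor 1 + 2l/(u - a + 1 - l) is (u - a + 1 + l)/(u - a + 1 - l). Partial fractions turn
    the product into a sum over i, and [ffactr_sum] expands each term in inverse falling factorials
    of u - a. *)
Lemma schurQ_gen (q : nat -> L) (a : L) :
  q 0%N = 1 ->
  (forall r, q r.+1 = 2%:R * \sum_(i < N) ffactr (lam i) r.+1 * schurQ_coef i) ->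
  ssum (fun r => cst (q r) * uinv_ffact a r) =
  \prod_(i < N) (1 + cst (2%:R * lam i) * uinv (a - 1 + lam i)) :> series L.
Proof.
move=> q0 qS.
rewrite (@partial_fractions L 'I_N lam (index_enum 'I_N) _ _ (series L) (@cst L)
  (fun i => uinv (a - 1 + lam i))); first last.
- move=> i j _ _; rewrite uinvB; congr (cst _ * _ * _); ring.
- by move=> i j _ _; exact: lam_inj.
- exact: index_enum_uniq.
apply/funext => n.
rewrite (@ssum_trunc _ _ n.+2) //; last by move=> r; apply/sord_cstM/sord_uinv_ffact.
rewrite big_ord_recl q0 rmorph1 mul1r uinv_ffactE big_ord0 coefs_add [RHS]coefs_add.
congr (_ + _).
(* The remainder after n + 1 terms of the telescoping sum; it has order at least n + 2 and is
   invisible at the coefficient n. *)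
pose R i := cst (ffactr (lam i) n.+2) * uinv (a - 1 + lam i) * uinv_ffact a n.+1 : series L.
have -> : \sum_(r < n.+1) cst (q (lift ord0 r)) * uinv_ffact a (lift ord0 r) =
    \sum_(i < N) cst (2%:R * schurQ_coef i) * (cst (lam i) * uinv (a - 1 + lam i) - R i) :> series L.
  under [RHS]eq_bigr do rewrite -ffactr_sum mulr_sumr.
  rewrite exchange_big /=; apply: eq_bigr => r _.
  rewrite /bump add1n qS mulr_sumr rmorph_sum mulr_suml; apply: eq_bigr => i _.
  by rewrite !rmorphM; ring.
rewrite !coefs_sum; apply: eq_bigr => i _.
rewrite mulrBr coefs_add coefs_opp [X in _ - X](_ : _ = 0) ?subr0.
  rewrite mulrA -rmorphM -/(schurQ_coef i); congr ((cst _ * _) n); ring.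
have so : sord (1 + n.+1) (uinv (a - 1 + lam i) * uinv_ffact a n.+1 : series L).
  by apply: sordM; [exact: sord_uinv | exact: sord_uinv_ffact].
by rewrite coefs_cstM /R -mulrA coefs_cstM so ?mulr0.
Qed.

End GeneratingFunctions.

Section Summation.
Variable A : nzRingType.
Implicit Types (s : nat -> series A) (x : series A).

Lemma ssumMl s x : (forall r, sord r (s r)) ->
  ssum (fun r => x * s r) = x * ssum s.
Proof.
move=> so; apply/funext => n; rewrite (@ssum_trunc _ _ n.+1) //; last first.
  by move=> r; rewrite -[r]add0n; apply: sordM.
rewrite -mulr_sumr; apply: (@smul_eq _ n) => // m mn.
by rewrite -ssum_trunc.
Qed.

Lemma ssum_recl s : (forall r, sord r (s r)) -> (forall r, sord r (s r.+1)) ->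
  ssum s = s 0%N + ssum (fun r => s r.+1).
Proof.
move=> so so1; apply/funext => n; rewrite (@ssum_trunc _ _ n.+2) //.
by rewrite big_ord_recl coefs_add -(ssum_trunc (s := fun r => s r.+1)).
Qed.

End Summation.

(** For t = 1/u, w = 1/(u+1), u0 = 1/(u+1-l), u1 = 1/(u-l) both sides are (u+1+l)(u+l)/(u(u+1)). The
    hypotheses are the resolvent identities among these four series. *)
Lemma capelli_factor (R : comNzRingType) (l t w u0 u1 : R) :
  t - w = t * w -> u0 - t = (l - 1) * u0 * t -> u0 - w = l * u0 * w ->
  u1 - t = l * u1 * t -> u1 - w = (l + 1) * u1 * w ->
  (1 + 2%:R * l * u0) * (1 - l * (l - 1) * (t * w)) =
  (1 - l * (l + 1) * (t * w)) * (1 + 2%:R * l * u1).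
Proof.
move=> tw u0t u0w u1t u1w.
have e0 : (l - 1) * l * u0 * (t * w) = l * (u0 - t) - (l - 1) * (u0 - w).
  by rewrite -tw u0t u0w; ring.
have e1 : l * (l + 1) * u1 * (t * w) = (l + 1) * (u1 - t) - l * (u1 - w).
  by rewrite -tw u1t u1w; ring.
have -> : (1 + 2 * l * u0) * (1 - l * (l - 1) * (t * w)) =
  1 + 2 * l * u0 - l * (l - 1) * (t * w) - 2 * l * ((l - 1) * l * u0 * (t * w)) by ring.
have -> : (1 - l * (l + 1) * (t * w)) * (1 + 2 * l * u1) =
  1 - l * (l + 1) * (t * w) + 2 * l * u1 - 2 * l * (l * (l + 1) * u1 * (t * w)) by ring.
rewrite e0 e1 -tw; ring.
Qed.

(** * Generating function of the cyclic elements *)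

Section CyclicGeneratingFunction.
Variables (L : fieldType) (N : nat) (lam : 'I_N -> L).
Variable p : nat -> 'I_N -> L.
Hypothesis p0 : forall i, p 0%N i = 1.
Hypothesis pS : forall s i, p s.+1 i = lam i * (lam i * p s i) - lam i * p s i
  - 2%:R * \sum_(k < N | (i < k)%N) lam k * p s k.

Local Notation W := (uinv 0 * uinv (-1) : series L).
Local Notation P i := (ssum (fun s => W ^+ s * cst (p s i)) : series L).
Local Notation num i := (1 - cst (lam i) * (cst (lam i) + 1) * W).
Local Notation den i := (1 - cst (lam i) * (cst (lam i) - 1) * W).

Lemma sordW : sord 1 W.
Proof. by apply: sordMl; exact: sord_uinv. Qed.

Lemma sordWX k a : sord k (W ^+ k * cst a).
Proof. by apply: sordMl; apply: sordX; exact: sordW. Qed.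

Lemma ssumWE (b : nat -> L) n :
  ssum (fun s => W ^+ s * cst (b s)) n = \sum_(s < n.+1) b s * (W ^+ s) n.
Proof. by apply: eq_bigr => s _; rewrite mulrC coefs_cstM. Qed.

Lemma power_gen i : P i = 1 + W * (cst (lam i) * (cst (lam i) - 1) * P i
   - cst 2%:R * \sum_(k < N | (i < k)%N) cst (lam k) * P k).
Proof.
rewrite {1}ssum_recl => [|r|r]; try exact: sordWX; last first.
  by rewrite exprS -mulrA; apply: (@sordM _ 0%N) => //; exact: sordWX.
rewrite p0 rmorph1 mulr1 expr0; congr (_ + _).
under [X in ssum X]funext do rewrite exprS -mulrA.
rewrite (@ssumMl _ (fun r => W ^+ r * cst (p r.+1 i))); last by move=> r; exact: sordWX.
congr (_ * _); apply/funext => n; rewrite ssumWE coefs_add coefs_opp.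
rewrite (_ : cst (lam i) * (cst (lam i) - 1) = cst (lam i * (lam i - 1))); last first.
  by rewrite rmorphM rmorphB rmorph1.
rewrite !coefs_cstM coefs_sum ssumWE.
under [X in _ - _ * X]eq_bigr do rewrite coefs_cstM ssumWE mulr_sumr.
rewrite exchange_big !mulr_sumr -sumrB; apply: eq_bigr => s _.
rewrite pS /= !mulrBl -!mulrA mulr_suml; congr (_ - _); last first.
  by congr (_ * _); apply: eq_bigr => k _; rewrite mulrA.
by ring.
Qed.

(* The partial products of num i / den i over i >= m. *)
Definition tail_gen (m : nat) : series L :=
  1 - W * (cst 2%:R * \sum_(k < N | (m <= k)%N) cst (lam k) * P k).

(** By [power_gen], the tail beyond i equals den i P i. Adding the i-th term subtracts 2 W lam_i P i
    from it, and den i - 2 lam_i W = num i. *)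
Lemma tail_gen_rec (i : 'I_N) : tail_gen i * den i = tail_gen i.+1 * num i.
Proof.
have Pi := power_gen i.
have -> : tail_gen i = tail_gen i.+1 - W * (cst 2%:R * (cst (lam i) * P i)).
  rewrite /tail_gen (bigD1 i) //= mulrDr mulrDr opprD addrA addrAC.
  congr (_ - _ * (_ * _) - _); apply: eq_bigl => k.
  by rewrite ltn_neqAle andbC eq_sym.
have {Pi} -> : tail_gen i.+1 = den i * P i by rewrite mulrBl mul1r {1}Pi /tail_gen; ring.
rewrite rmorph_nat; ring.
Qed.

Lemma cyclic_gen :
  (1 - ssum (fun s => W ^+ s.+1 * cst (2%:R * \sum_i lam i * p s i)))
    * \prod_i den i = \prod_i num i.
Proof.
have -> : 1 - ssum (fun s => W ^+ s.+1 * cst (2%:R * \sum_i lam i * p s i)) = tail_gen 0.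
  congr (1 - _).
  under [X in ssum X]funext do rewrite exprS -mulrA.
  rewrite (@ssumMl _ (fun s => W ^+ s * cst (2%:R * \sum_i lam i * p s i))); last first.
    by move=> r; exact: sordWX.
  congr (_ * _); apply/funext => n; rewrite ssumWE coefs_cstM coefs_sum.
  under [X in _ = _ * X]eq_bigr do rewrite coefs_cstM ssumWE mulr_sumr.
  rewrite exchange_big mulr_sumr; apply: eq_bigr => s _.
  rewrite -mulrA mulr_suml; congr (_ * _).
  by apply: eq_bigr => k _; rewrite mulrA.
have H m : (m <= N)%N ->
    tail_gen 0 * \prod_(i < N | (i < m)%N) den i = tail_gen m * \prod_(i < N | (i < m)%N) num i.
  elim: m => [|m IH] mN; first by rewrite !big_pred0.
  pose i := Ordinal mN.
  have E (f : 'I_N -> series L) : \prod_(k < N | (k < m.+1)%N) f k =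
      f i * \prod_(k < N | (k < m)%N) f k.
    rewrite (bigD1 i) //=; congr (_ * _); apply: eq_bigl => k.
    by rewrite ltnS -val_eqE /= [RHS]ltn_neqAle andbC.
  rewrite !E mulrCA IH; last exact: ltnW.
  by rewrite [LHS]mulrA [X in X * _ = _]mulrC (tail_gen_rec i) [RHS]mulrA.
have := H N (leqnn N).
have allN (f : 'I_N -> series L) : \prod_(k < N | (k < N)%N) f k = \prod_k f k.
  by apply: eq_bigl => k; rewrite ltn_ord.
rewrite !allN => ->; rewrite /tail_gen [X in 1 - _ * (_ * X)]big_pred0 => [|k].
  by rewrite !mulr0 subr0 mul1r.
by rewrite leqNgt ltn_ord.
Qed.

Lemma den_coef0 : (\prod_i den i) 0%N = 1.
Proof.
apply: (big_ind (fun f : series L => f 0%N = 1)) => // [f g f0 g0|i _].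
  by rewrite -[LHS]/(smul f g 0%N) /smul big_ord1 f0 g0 mulr1.
have so := @sordMl _ _ _ (cst (lam i) * (cst (lam i) - 1)) sordW.
by rewrite coefs_add coefs_opp mulrC so ?subr0.
Qed.

(** The product of the den i has constant term 1 and can be cancelled; the identity then splits into
    one instance of [capelli_factor] for each i. The poles of the two outer products are at u =
    lam_i - 1 and u = lam_i. *)
Lemma capelli_cyclic_gen :
  \prod_i (1 + cst (2%:R * lam i) * uinv (0 - 1 + lam i)) =
  (1 - ssum (fun s => W ^+ s.+1 * cst (2%:R * \sum_i lam i * p s i)))
  * \prod_i (1 + cst (2%:R * lam i) * uinv (1 - 1 + lam i)) :> series L.
Proof.
set c := (X in _ = X * _); set g0 := (X in X = _); set g1 := (X in _ = _ * X).
suff E : g0 * \prod_i den i = c * g1 * \prod_i den i.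
  have dI := smul_sinv den_coef0.
  by rewrite -[LHS]mulr1 -[RHS]mulr1 -dI !mulrA E.
rewrite mulrAC cyclic_gen /g0 /g1 -!big_split; apply: eq_bigr => i _ /=.
rewrite rmorphM rmorph_nat; apply: capelli_factor.
- by rewrite uinvB sub0r opprK rmorph1 mul1r.
- rewrite uinvB (_ : cst (lam i) - 1 = cst (lam i - 1)).
    by congr (cst _ * _ * _); ring.
  by rewrite rmorphB rmorph1.
- by rewrite uinvB; congr (cst _ * _ * _); ring.
- by rewrite uinvB; congr (cst _ * _ * _); ring.
- rewrite uinvB (_ : cst (lam i) + 1 = cst (lam i + 1)).
    by congr (cst _ * _ * _); ring.
  by rewrite rmorphD rmorph1.
Qed.

End CyclicGeneratingFunction.

(** * Comparison of the two sides *)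

Section MapSeries.
Variables (A B : comNzRingType) (phi : {rmorphism A -> B}).

Definition smap (f : series A) : series B := fun n => phi (f n).

Lemma smapM f g : smap (f * g) = smap f * smap g.
Proof.
apply/funext => n; rewrite /smap -[(f * g) n]/(smul f g n) rmorph_sum.
by apply: eq_bigr => i _; rewrite rmorphM.
Qed.

Lemma smap1 : smap 1 = 1.
Proof. by apply/funext => n; rewrite -[LHS]/(phi (n == 0%N)%:R) rmorph_nat. Qed.

Lemma smap_uinv a : smap (uinv a) = uinv (phi a).
Proof. by apply/funext => -[|n]; rewrite /smap /= ?rmorph0 ?rmorphXn. Qed.

Lemma smapX f k : smap (f ^+ k) = smap f ^+ k.
Proof. by elim: k => [|k IH]; rewrite ?expr0 ?smap1 // !exprS smapM IH. Qed.

Lemma smap_uinv_ffact a r : smap (uinv_ffact a r) = uinv_ffact (phi a) r.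
Proof.
elim: r => [|r IH]; first by rewrite !uinv_ffactE !big_ord0 smap1.
by rewrite !uinv_ffactS smapM IH smap_uinv rmorphD rmorph_nat.
Qed.

End MapSeries.

Section Main.
Variables (C : numClosedFieldType) (N : nat).
Local Notation U := (Uq C N).
Local Notation Pm := {mpoly C[N]}.
Local Notation L := {fraction Pm}.
Local Notation "x %:F" := (@tofrac _ x).

Let iota : {rmorphism C -> L} := (@tofrac Pm) \o (@mpolyC N C).
Let lam (i : 'I_N) : L := ('X_i : Pm)%:F.

Lemma lam_inj : injective lam.
Proof.
move=> i j /eqP; rewrite tofrac_eq => /eqP /(congr1 (mcoeff U_(i)%MM)).
rewrite !mcoeffXU eqxx; have [->//|_ /eqP] := eqVneq j i.
by rewrite oner_eq0.
Qed.

Lemma tofracZ k (x : Pm) : (k *: x)%:F = iota k * x%:F.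
Proof. by rewrite -mul_mpolyC rmorphM. Qed.

Lemma Qfact_schurQ r :
  Qfact C N r = 2%:R * \sum_(i < N) ffactr (lam i) r * schurQ_coef lam i.
Proof.
congr (_ * _); apply: eq_bigr => i _; rewrite rmorph_prod; congr (_ * _).
  by apply: eq_bigr => k _; rewrite rmorphB rmorph_nat.
by apply: eq_bigr => j _; rewrite rmorphB rmorphD.
Qed.

Lemma capelli_cyclic (D : nat -> U) :
  D 0%N = 1 -> (forall r : nat, (1 <= r)%N -> is_capelli r (D r)) ->
  smul (ffact_series D 0) (sinv (ffact_series D 1)) =
  ssub (sone _) (ssum (fun r : nat =>
          sscale (spow (smul (uinv 0) (uinv (- 1))) r.+1)
            (cyclic_elt C N (2 * r.+1 - 1)))).
Proof.
move=> D0 DC.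
(* A polynomial is chosen for every D_r at once. The index 0 is separate, since the rational
   expression of Q^-_(r) holds only for r >= 1. *)
have /boolp.choice[f fP] : forall r, exists g : Pm, central_HC (D r) g /\
    g%:F = if r is 0 then 1 else Qfact C N r.
  case=> [|r].
    by exists 1; rewrite D0 tofrac1; split=> //; exact: central_HC1.
  have [Dz [g gHC gF]] := DC r.+1 isT.
  by exists g; split=> //; exact: ZN_central_HC.
pose h s : Pm := 2%:R *: \sum_(i < N) 'X_i * cyc_poly C s i.
pose W k : series C := spow (smul (uinv 0) (uinv (- 1))) k.
pose c := ssub (sone _) (ssum (fun r : nat =>
          sscale (W r.+1) (cyclic_elt C N (2 * r.+1 - 1)))).
pose cP : series Pm := ssub (sone _) (ssum (fun r : nat => sscale (W r.+1) (h r))).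
rewrite -[RHS]/c.
have ffHC a n : central_HC (ffact_series D a n) (ffact_series f a n).
  by apply: central_HC_sum => r _; apply: central_HCZ; have [] := fP r.
have cHC n : central_HC (c n) (cP n).
  apply: central_HCB.
    rewrite /sone; case: (n == 0%N); [exact: central_HC1 | exact: central_HC0].
  apply: central_HC_sum => r _; apply: central_HCZ.
  have -> : (2 * r.+1 - 1 = r.*2.+1)%N by rewrite mul2n doubleS subn1.
  by apply: cyclic_elt_HC; rewrite pnatr_eq0.
(* The series over U do not commute: c stands on the left, so that the right inverse [sinv]
   cancels. *)
suff E : ffact_series D 0 = c * (ffact_series D 1 : series U).
  rewrite E -[LHS]/(c * (ffact_series D 1 : series U) * _) -mulrA smul_sinv ?mulr1 //.
  rewrite /ffact_series /ssum big_ord1 D0 /sscale /uinv_ffact big_ord0.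
  by rewrite scale1r.
(* The n-th coefficient of the difference is central, and its HC is the same expression in the
   polynomials [f] and [h]; by injectivity it suffices that this polynomial vanishes. *)
apply/funext => n; apply/eqP; rewrite -subr_eq0; apply/eqP/central_HC_inj.
suff e0 : ffact_series f 0 n - smul cP (ffact_series f 1) n = 0.
  rewrite -e0; apply: central_HCB; first exact: ffHC.
  by apply: central_HC_sum => i _; exact: central_HCM.
(* The comparison takes place in the fraction field, where the denominators lam_i - lam_j are
   invertible; polynomials embed there. *)
pose q r : L := if r is 0 then 1 else Qfact C N r.
have ffF a : smap (@tofrac Pm) (ffact_series f a) =
    \prod_(i < N) (1 + cst (2%:R * lam i) * uinv (iota a - 1 + lam i)) :> series L.
  rewrite -(schurQ_gen lam_inj (q := q)) //; last by move=> r; rewrite -Qfact_schurQ.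
  apply/funext => m; rewrite /smap rmorph_sum; apply: eq_bigr => r _.
  apply: etrans (tofracZ _ _) _; rewrite coefs_cstM mulrC; have [_ ->] := fP r.
  by rewrite -[iota _]/(smap iota _ _) smap_uinv_ffact.
have W1 : smap iota (smul (uinv 0) (uinv (-1))) = uinv 0 * uinv (-1).
  by rewrite [LHS](smapM iota (uinv 0) (uinv (-1))) !smap_uinv rmorph0 rmorphN1.
have WF k : smap iota (W k) = (uinv 0 * uinv (-1)) ^+ k.
  by rewrite /W spowE smapX W1.
have cF : smap (@tofrac Pm) cP = 1 - ssum (fun s => (uinv 0 * uinv (-1)) ^+ s.+1
      * cst (2%:R * \sum_i lam i * (cyc_poly C s i)%:F)) :> series L.
  apply/funext => m; rewrite /smap rmorphB coefs_add coefs_opp; congr (_ - _).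
    by rewrite rmorph_nat.
  rewrite rmorph_sum; apply: eq_bigr => r _.
  apply: etrans (tofracZ _ _) _; rewrite [in RHS]mulrC coefs_cstM mulrC; congr (_ * _).
    apply: etrans (tofracZ _ _) _; rewrite rmorph_nat rmorph_sum; congr (_ * _).
    by apply: eq_bigr => i _; rewrite rmorphM.
  by rewrite -[iota _]/(smap iota _ _) WF.
apply/eqP; rewrite -tofrac_eq0 rmorphB subr_eq0; apply/eqP.
rewrite -[LHS]/(smap (@tofrac Pm) _ n) -[RHS]/(smap (@tofrac Pm) (cP * _) n).
rewrite smapM !ffF cF rmorph0 rmorph1.
rewrite (@capelli_cyclic_gen L N lam (fun s i => (cyc_poly C s i)%:F)) // => s i.
rewrite /= !rmorphB !rmorphM scaler_nat rmorphMn rmorph_sum mulr_natl.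
by congr (_ - _ *+ _); apply: eq_bigr => k _; rewrite rmorphM.
Qed.

End Main.

Theorem theorem1p1 (R : realType) (N : nat) (D : nat -> Uq R[i] N) :
  (1 <= N)%N ->
  D 0%N = 1 ->
  (forall r : nat, (1 <= r)%N -> is_capelli r (D r)) ->
  smul (ffact_series D 0) (sinv (ffact_series D 1))
  =1 ssub (sone _)
       (ssum (fun r : nat =>
          sscale (spow (smul (uinv 0) (uinv (- 1))) r.+1)
            (cyclic_elt R[i] N (2 * r.+1 - 1)))).
Proof.
by move=> _ D0 DC n; rewrite (@capelli_cyclic R[i] N D D0 DC).
Qed.
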